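(* Let $U$ be a left vector space over a (not necessarily commutative) field $K$ and $U'$ a left vector space over a (not necessarily commutative) field $K'$, with $1\le\dim U<\infty$ and $1\le\dim U'<\infty$. Let $R=\mathrm{End}_K(U)$ and $R'=\mathrm{End}_{K'}(U')$. A bijection $\varphi:\mathbb P(R)\to\mathbb P(R')$ is a $\triangle$-isomorphism if, and only if, one of the following conditions is satisfied: (a) $\dim U=\dim U'=1$. (b) $\dim U>1$ and $\varphi=\widetilde\alpha\,\widetilde\gamma$ (first $\widetilde\alpha$, then $\widetilde\gamma$), where $\alpha:R\to R'$ is either an isomorphism or an anti-isomorphism of rings, and $\gamma\in\mathrm{GL}_2(R')$. Moreover, for $\dim U>1$, the mapping $\alpha$ can be written either as $x\mapsto h^{-1}xh$ with a semilinear bijection $h:U\to U'$ (when $\alpha$ is an isomorphism), or as $x\mapsto h^{-1}x^{\mathrm T}h$ with a semilinear bijection $h:\widehat U\to U'$ (when $\alpha$ is an anti-isomorphism), respectively.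
   Context: Rings are associative with unit $1\ne0$ (preserved by homomorphisms and anti-homomorphisms). Fields need not be commutative. Mappings are written on the right as exponents, and products of mappings (including products in endomorphism rings) are read from left to right: $x^{fg}=(x^f)^g$. Projective line: $\mathbb P(R)$ is the set of all submodules $R(a,b)$ of the left module $R^2$ such that $(a,b)$ is the first row of a matrix in $\mathrm{GL}_2(R)$. Points $p,q\in\mathbb P(R)$ are distant, $p\,\triangle\,q$, if $p=R(a,b)$, $q=R(c,d)$ for some matrix $\begin{pmatrix}a&b\\c&d\end{pmatrix}\in\mathrm{GL}_2(R)$. A $\triangle$-isomorphism $\varphi:\mathbb P(R)\to\mathbb P(R')$ is a bijection with $p\,\triangle\,q\Leftrightarrow p^\varphi\,\triangle\,q^\varphi$ for all $p,q$. For $\gamma\in\mathrm{GL}_2(R')$, the projectivity $\widetilde\gamma$ of $\mathbb P(R')$ is $R'(a,b)\mapsto R'\big((a,b)\gamma\big)$. For a ring homomorphism $\alpha:R\to R'$, $\widetilde\alpha:\mathbb P(R)\to\mathbb P(R')$ is $R(a,b)\mapsto R'(a^\alpha,b^\alpha)$. For a ring anti-homomorphism $\alpha:R\to R'$, $\widetilde\alpha:\mathbb P(R)\to\mathbb P(R')$ is $p\mapsto R'(-w^\alpha,v^\alpha)$, where $p=R(a,b)$, $M\in\mathrm{GL}_2(R)$ is any matrix with first row $(a,b)$, and $(v,w)^{\mathrm T}$ is the second column of $M^{-1}$; this is known to be well defined (and to agree with the previous definition if $\alpha$ is both a homomorphism and an anti-homomorphism). $\widehat U$ is the dual space of $U$,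 a right vector space over $K$, with canonical pairing $\langle\cdot,\cdot\rangle:U\times\widehat U\to K$. For $x\in\mathrm{End}_K(U)$, $x^{\mathrm T}\in\mathrm{End}_K(\widehat U)$ is the transpose mapping, i.e. $\langle u^x,\widehat u\rangle=\langle u,\widehat u^{\,x^{\mathrm T}}\rangle$. A semilinear bijection $U\to U'$ is taken with respect to an accompanying isomorphism $K\to K'$; a semilinear bijection $\widehat U\to U'$ (from a right to a left vector space) is taken with respect to an accompanying anti-isomorphism $K\to K'$. *)

(* Defs.v *)
From HB Require Import structures.
From mathcomp Require Import all_boot all_order all_algebra.
From mathcomp Require Import boolp classical_sets.

Set Implicit Arguments.
Unset Strict Implicit.
Unset Printing Implicit Defensive.

Import GRing.Theory.
Local Open Scope classical_set_scope.
Local Open Scope ring_scope.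

(* Rings are not assumed to be commutative, so [unitmx] and ['GL_n] do not
   apply. *)
Definition GL2 (R : pzRingType) : set 'M[R]_2 :=
  [set M | exists N, M *m N = 1%:M /\ N *m M = 1%:M].
Arguments GL2 R : clear implicits.

Definition cyclic_submod (R : pzRingType) (v : 'rV[R]_2) : set 'rV[R]_2 :=
  [set c *: v | c in [set: R]].

Definition proj_line (R : pzRingType) : set (set 'rV[R]_2) :=
  [set cyclic_submod (row 0 M) | M in GL2 R].
Arguments proj_line R : clear implicits.

Definition distant (R : pzRingType) (p q : proj_line R) : Prop :=
  exists2 M, GL2 R M &
    val p = cyclic_submod (row 0 M) /\ val q = cyclic_submod (row 1 M).

Definition dist_isomorphism (R R' : pzRingType)
    (phi : proj_line R -> proj_line R') : Prop :=
  bijective phi /\ forall p q, distant p q <-> distant (phi p) (phi q).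

(* A frame of p is a pair of mutually inverse matrices (M, N) such that p is
   generated by the first row of M.  The maps between projective lines below
   are computed on an arbitrarily chosen frame; the lemmas [projectivityE],
   [hom_tildeE] and [anti_tildeE] show that the choice is irrelevant. *)
Definition is_frame (R : pzRingType) (p : set 'rV[R]_2)
    (MN : 'M[R]_2 * 'M[R]_2) : Prop :=
  [/\ MN.1 *m MN.2 = 1%:M, MN.2 *m MN.1 = 1%:M & p = cyclic_submod (row 0 MN.1)].

Lemma frame_exists (R : pzRingType) (p : proj_line R) :
  exists MN, is_frame (val p) MN.
Proof.
by case: p => p /= /set_mem [M [N [MN NM]] <-]; exists (M, N).
Qed.

Definition frame (R : pzRingType) (p : proj_line R) : 'M[R]_2 * 'M[R]_2 :=
  sval (cid (frame_exists p)).

Lemma frameP (R : pzRingType) (p : proj_line R) : is_frame (val p) (frame p).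
Proof. exact: svalP (cid (frame_exists p)). Qed.

Lemma cyclic_subset (R : pzRingType) (v w : 'rV[R]_2) c :
  v = c *: w -> cyclic_submod v `<=` cyclic_submod w.
Proof. by move=> -> _ [d _ <-]; exists (d * c) => //=; rewrite scalerA. Qed.

Lemma cyclic_eq (R : pzRingType) (v w : 'rV[R]_2) c d :
  v = c *: w -> w = d *: v -> cyclic_submod v = cyclic_submod w.
Proof.
move=> vw wv; apply/seteqP.
by split; [exact: cyclic_subset vw | exact: cyclic_subset wv].
Qed.

Lemma cyclic_mem (R : pzRingType) (v w : 'rV[R]_2) :
  cyclic_submod v = cyclic_submod w -> exists c, v = c *: w.
Proof.
move=> vw; have : cyclic_submod v v by exists 1 => //=; rewrite scale1r.
by rewrite vw => -[c _ <-]; exists c.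
Qed.

Section Projectivity.
Variables (R : pzRingType) (gamma : GL2 R).

Lemma projectivity_subproof (p : proj_line R) :
  cyclic_submod (row 0 (frame p).1 *m val gamma) \in proj_line R.
Proof.
have [MN NM _] := frameP p; have [H [GH HG]] := set_mem (valP gamma).
apply/mem_set; exists ((frame p).1 *m val gamma); last by rewrite row_mul.
exists (H *m (frame p).2); split.
  by rewrite mulmxA -(mulmxA (frame p).1) GH mulmx1.
by rewrite mulmxA -(mulmxA H) NM mulmx1.
Qed.

Definition projectivity (p : proj_line R) : proj_line R :=
  SigSub (projectivity_subproof p).

Lemma projectivityE (p : proj_line R) M : GL2 R M ->
  val p = cyclic_submod (row 0 M) ->
  val (projectivity p) = cyclic_submod (row 0 M *m val gamma).
Proof.
move=> _ pM; have [_ _ pF] := frameP p; rewrite /=.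
have [c cE] : exists c, row 0 M = c *: row 0 (frame p).1.
  by apply: cyclic_mem; rewrite -pM -pF.
have [d dE] : exists d, row 0 (frame p).1 = d *: row 0 M.
  by apply: cyclic_mem; rewrite -pM -pF.
by apply: (@cyclic_eq _ _ _ d c); rewrite scalemxAl -?cE -?dE.
Qed.
End Projectivity.

Section HomTilde.
Variables (R R' : pzRingType) (alpha : {rmorphism R -> R'}).

Lemma hom_tilde_subproof (p : proj_line R) :
  cyclic_submod (map_mx alpha (row 0 (frame p).1)) \in proj_line R'.
Proof.
have [MN NM _] := frameP p.
apply/mem_set; exists (map_mx alpha (frame p).1); last by rewrite map_row.
by exists (map_mx alpha (frame p).2); rewrite -!map_mxM MN NM map_mx1.
Qed.

Definition hom_tilde (p : proj_line R) : proj_line R' :=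
  SigSub (hom_tilde_subproof p).

Lemma hom_tildeE (p : proj_line R) M : GL2 R M ->
  val p = cyclic_submod (row 0 M) ->
  val (hom_tilde p) = cyclic_submod (map_mx alpha (row 0 M)).
Proof.
move=> _ pM; have [_ _ pF] := frameP p.
have [c cE] : exists c, row 0 M = c *: row 0 (frame p).1.
  by apply: cyclic_mem; rewrite -pM -pF.
have [d dE] : exists d, row 0 (frame p).1 = d *: row 0 M.
  by apply: cyclic_mem; rewrite -pM -pF.
by apply: (@cyclic_eq _ _ _ (alpha d) (alpha c)); rewrite -map_mxZ -?cE -?dE.
Qed.
End HomTilde.

(* Ring anti-homomorphisms R -> R' are ring homomorphisms R^c -> R'. *)
Section AntiTilde.
Variables (R R' : pzRingType) (alpha : {rmorphism R^c -> R'}).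

Let alphaD (x y : R) : alpha (x + y) = alpha x + alpha y.
Proof. exact: rmorphD. Qed.
Let alphaM (x y : R) : alpha (x * y) = alpha y * alpha x.
Proof. exact: (rmorphM alpha (y : R^c) (x : R^c)). Qed.

(* If (v, w)^T is the second column of N, this is (- alpha w, alpha v). *)
Definition anti_row (N : 'M[R]_2) : 'rV[R']_2 :=
  \row_j (if j == 0 then - alpha (N 1 1) else alpha (N 0 1)).

Let anti_mx (N : 'M[R]_2) : 'M[R']_2 :=
  \matrix_(i, j) (if i == j then - alpha (N (1 - j) (1 - i))
                            else alpha (N (1 - j) (1 - i))).

Let ord2P (i : 'I_2) : i = 0 \/ i = 1.
Proof. by case: i => [[|[|//]] h]; [left|right]; apply/val_inj. Qed.

Let sum2 (S : pzRingType) (F : 'I_2 -> S) : \sum_i F i = F 0 + F 1.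
Proof.
by rewrite !big_ord_recl big_ord0 addr0; congr (_ + F _); apply/val_inj.
Qed.

Let sub11 : 1 - 1 = 0 :> 'I_2. Proof. exact/val_inj. Qed.
Let sub10 : 1 - 0 = 1 :> 'I_2. Proof. exact/val_inj. Qed.

Let row_anti_mx N : row 0 (anti_mx N) = anti_row N.
Proof.
by apply/rowP=> j; rewrite !mxE; case: (ord2P j) => ->;
  rewrite /= ?sub11 ?sub10.
Qed.

Let anti_mxM (M N : 'M[R]_2) :
  N *m M = 1%:M -> anti_mx M *m anti_mx N = 1%:M.
Proof.
move=> NM.
have H i j : alpha (N i 0 * M 0 j) + alpha (N i 1 * M 1 j) = (i == j)%:R.
  have := congr1 (fun A : 'M[R]_2 => A i j) NM; rewrite !mxE sum2 -alphaD => ->.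
  exact: (rmorph_nat alpha).
apply/matrixP=> i j; rewrite !mxE sum2 !mxE.
case: (ord2P i) => ->; case: (ord2P j) => ->;
  rewrite /= ?sub11 ?sub10 ?mulrNN ?mulrN ?mulNr -!alphaM.
- by rewrite addrC H.
- by rewrite -opprD addrC H oppr0.
- by rewrite -opprD addrC H oppr0.
- by rewrite addrC H.
Qed.
Lemma anti_tilde_subproof (p : proj_line R) :
  cyclic_submod (anti_row (frame p).2) \in proj_line R'.
Proof.
have [MN NM _] := frameP p.
apply/mem_set; exists (anti_mx (frame p).2); last by rewrite row_anti_mx.
by exists (anti_mx (frame p).1); split; exact: anti_mxM.
Qed.

Definition anti_tilde (p : proj_line R) : proj_line R' :=
  SigSub (anti_tilde_subproof p).

Let anti_row_scale (M1 N1 M2 N2 : 'M[R]_2) c :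
    M1 *m N1 = 1%:M -> M2 *m N2 = 1%:M -> N2 *m M2 = 1%:M ->
    row 0 M2 = c *: row 0 M1 ->
  exists d, anti_row N1 = d *: anti_row N2.
Proof.
move=> MN1 MN2 NM2 rM.
have M2N1 : (M2 *m N1) 0 1 = 0.
  have -> : (M2 *m N1) 0 1 = (row 0 M2 *m N1) 0 1 by rewrite -row_mul [RHS]mxE.
  by rewrite rM -scalemxAl -row_mul MN1 !mxE mulr0.
have E i : N1 i 1 = N2 i 1 * (M2 *m N1) 1 1.
  have -> : N1 i 1 = (N2 *m (M2 *m N1)) i 1 by rewrite mulmxA NM2 mul1mx.
  by rewrite mxE sum2 M2N1 mulr0 add0r.
move: ((M2 *m N1) 1 1) E => d E; exists (alpha d); apply/rowP=> j; rewrite !mxE.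
by rewrite !E !alphaM; case: (j == 0); rewrite // mulrN.
Qed.

Lemma anti_tildeE (p : proj_line R) M N : M *m N = 1%:M -> N *m M = 1%:M ->
  val p = cyclic_submod (row 0 M) ->
  val (anti_tilde p) = cyclic_submod (anti_row N).
Proof.
move=> MN NM pM; have [MNF NMF pF] := frameP p.
have [c cE] : exists c, row 0 M = c *: row 0 (frame p).1.
  by apply: cyclic_mem; rewrite -pM -pF.
have [d dE] : exists d, row 0 (frame p).1 = d *: row 0 M.
  by apply: cyclic_mem; rewrite -pM -pF.
have [e eE] := anti_row_scale MNF MN NM cE.
have [f fE] := anti_row_scale MN MNF NMF dE.
exact: cyclic_eq eE fE.
Qed.
End AntiTilde.

(* ['End(U)] carries no ring structure in the library when K is not
   commutative.  Products are read from left to right: (x * y) u = y (x u). *)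
Definition endo (K : nzRingType) (U : vectType K) : Type := 'End(U).

Section EndoRing.
Variables (K : nzRingType) (U : vectType K).

HB.instance Definition _ := GRing.Zmodule.on (endo U).

Definition endo_one : endo U := \1%VF.
Definition endo_mul (x y : endo U) : endo U := (y \o x)%VF.

Fact endo_mulA : associative endo_mul.
Proof. by move=> x y z; rewrite /endo_mul comp_lfunA. Qed.
Fact endo_mul1r : left_id endo_one endo_mul.
Proof. by move=> x; exact: comp_lfun1r. Qed.
Fact endo_mulr1 : right_id endo_one endo_mul.
Proof. by move=> x; exact: comp_lfun1l. Qed.
Fact endo_mulDl : left_distributive endo_mul +%R.
Proof. by move=> x y z; exact: comp_lfunDr. Qed.
Fact endo_mulDr : right_distributive endo_mul +%R.
Proof. by move=> x y z; exact: comp_lfunDl. Qed.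

HB.instance Definition _ := GRing.Zmodule_isPzRing.Build (endo U)
  endo_mulA endo_mul1r endo_mulr1 endo_mulDl endo_mulDr.
End EndoRing.

(* The right K-vector space of linear forms on U, encoded as a left vector
   space over K^c: k *: f is the form u |-> f u * k. *)
Definition dual (K : nzRingType) (U : vectType K) : Type := 'Hom(U, K^o).

Section Dual.
Variables (K : nzRingType) (U : vectType K).

HB.instance Definition _ := GRing.Zmodule.on (dual U).

Definition pairing (u : U) (f : dual U) : K := (f : 'Hom(U, K^o)) u.

Definition dual_scale (k : K^c) (f : dual U) : dual U :=
  linfun (fun u => (pairing u f * k : K^o)).

Fact dual_scaleE k f u : pairing u (dual_scale k f) = pairing u f * k.
Proof.
have lin : linear (fun u => (pairing u f * k : K^o)).
  by move=> a v w; rewrite /pairing linearP mulrDl /= -mulrA.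
pose g : {linear U -> K^o} := HB.pack (fun u => (pairing u f * k : K^o))
  (GRing.isLinear.Build K U K^o _ _ lin).
exact: (lfunE g).
Qed.

Fact dual_eq (f g : dual U) : (forall u, pairing u f = pairing u g) -> f = g.
Proof. by move=> fg; apply/lfunP. Qed.

Fact dual_addE (f g : dual U) u :
  pairing u (f + g) = pairing u f + pairing u g.
Proof. exact: (@add_lfunE K U K^o f g u). Qed.

Fact dual_scaleA (a b : K^c) f :
  dual_scale a (dual_scale b f) = dual_scale (a * b) f.
Proof. by apply: dual_eq => u; rewrite !dual_scaleE -mulrA. Qed.
Fact dual_scale1 : left_id 1 dual_scale.
Proof. by move=> f; apply: dual_eq => u; rewrite dual_scaleE mulr1. Qed.
Fact dual_scaleDr : right_distributive dual_scale +%R.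
Proof.
move=> a f g; apply: dual_eq => u.
by rewrite dual_addE !dual_scaleE dual_addE mulrDl.
Qed.
Fact dual_scaleDl f : {morph dual_scale^~ f : a b / a + b}.
Proof.
move=> a b; apply: dual_eq => u.
by rewrite dual_addE !dual_scaleE mulrDr.
Qed.

HB.instance Definition _ := GRing.Zmodule_isLmodule.Build K^c (dual U)
  dual_scaleA dual_scale1 dual_scaleDr dual_scaleDl.

Definition transpose (x : endo U) (f : dual U) : dual U := (f \o x)%VF.

Lemma transposeE (x : endo U) u f :
  pairing ((x : 'End(U)) u) f = pairing u (transpose x f).
Proof. by rewrite /pairing comp_lfunE. Qed.
End Dual.

(* Main.v *)
Require Import Defs.
From HB Require Import structures.
From mathcomp Require Import all_boot all_order all_algebra.
From mathcomp Require Import boolp classical_sets.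

(** Let [phi] be a distance isomorphism and [dim U > 1].  Composing with a
    projectivity, [phi] fixes R(1,0), R(0,1) and R(1,1), hence maps R(x,1) to
    R'(f x,1) for a bijection [f] with f 0 = 0, f 1 = 1 for which [f y - f x] is
    a unit if and only if [y - x] is.

    The points p, q are called adjacent if there is a third point c such that
    every point distant to c is distant to p or to q.  Adjacency is thus
    preserved by [phi], and R(x,1), R(y,1) are adjacent exactly when [y - x] has
    rank one.  Hence [f] preserves rank-one differences in both directions, and
    an affine form of Hua's theorem applies.  The maximal cliques through 0 are
    the sets of tensors with a fixed vector or with a fixed form, and [f] either
    preserves or exchanges these two types; the second case becomes the first
    one when the roles of U' and its dual are exchanged.  Cliques of the type
    J_r = {r (x) u | u} are mapped to parallel cliques on every translate of
    J_r, which forces [f] to be additive.  Then f (r (x) u) = g r (x) h u, and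
    since 1 - r (x) u is a unit if and only if r u <> 1, [f] is multiplicative
    (or anti-multiplicative).

    Finally [phi] agrees with the map induced by [f] at all points, because a
    point is determined by the points R(x,1) distant to it. *)

Set Implicit Arguments.
Unset Strict Implicit.
Unset Printing Implicit Defensive.

Import GRing.Theory.
Local Open Scope ring_scope.

(** * Points and distance over an arbitrary ring *)

(** A point R(a,b) is also the subspace of all (ap a z, ap b z) in U x U. Distant points share no
    nonzero vector, and adjacent affine points share a hyperplane; questions about units thus become
    a search for common vectors.

    The obstacle is that nothing algebraic is known about [f] at first, and that K may have two
    elements, so that a line of tensors carries hardly any structure. Hence only whole maximal
    cliques are compared. Comparing them at 0 does not suffice: their translates are followed with
    [recentre] before additivity is available.

    The condition dim U > 1 supplies the independent vectors and forms that separate the two types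
    of cliques and that fix the scalars in f (r (x) u) = g r (x) h u.

    That a point is determined by the affine points distant to it rests on a stable range property:
    every point has such an affine point at all.

    The semilinear description concerns [alpha] alone: it holds for every bijective [alpha] and
    comes from evaluating [alpha] on a one-sided ideal of tensors. *)

Section TwoByTwo.
Variable R : pzRingType.
Implicit Types (a b c d x y : R) (p q : proj_line R).

Definition unit_elt x := exists y, x * y = 1 /\ y * x = 1.

Lemma unit_elt1 : unit_elt 1. Proof. by exists 1; rewrite mulr1. Qed.
Lemma unit_eltN x : unit_elt (- x) <-> unit_elt x.
Proof.
split=> -[y [xy yx]]; exists (- y); last by rewrite !mulrNN.
by rewrite mulrN -mulNr xy mulNr -mulrN yx.
Qed.
Lemma unit_eltM x y : unit_elt x -> unit_elt y -> unit_elt (x * y).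
Proof.
move=> [x' [xx x'x]] [y' [yy y'y]]; exists (y' * x'); split.
  by rewrite mulrA -(mulrA x) yy mulr1.
by rewrite mulrA -(mulrA y') x'x mulr1.
Qed.

Definition rw a b : 'rV[R]_2 := \row_j (if j == 0 then a else b).
Definition mx2 a b c d : 'M[R]_2 :=
  \matrix_(i, j) (if i == 0 then if j == 0 then a else b
                  else if j == 0 then c else d).

Lemma ord2P (i : 'I_2) : i = 0 \/ i = 1.
Proof. by case: i => [[|[|//]] h]; [left|right]; apply/val_inj. Qed.

Lemma sum2 (F : 'I_2 -> R) : \sum_i F i = F 0 + F 1.
Proof.
by rewrite !big_ord_recl big_ord0 addr0; congr (_ + F _); apply/val_inj.
Qed.

Lemma rwE (v : 'rV[R]_2) : v = rw (v 0 0) (v 0 1).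
Proof. by apply/rowP => j; rewrite mxE; case: (ord2P j) => ->. Qed.
Lemma mx2E (M : 'M[R]_2) : M = mx2 (M 0 0) (M 0 1) (M 1 0) (M 1 1).
Proof.
by apply/matrixP => i j; rewrite mxE; case: (ord2P i) => ->;
  case: (ord2P j) => ->.
Qed.
Lemma row0_mx2 a b c d : row 0 (mx2 a b c d) = rw a b.
Proof. by apply/rowP => j; rewrite !mxE. Qed.
Lemma row1_mx2 a b c d : row 1 (mx2 a b c d) = rw c d.
Proof. by apply/rowP => j; rewrite !mxE. Qed.
Lemma mul_mx2 a b c d a' b' c' d' : mx2 a b c d *m mx2 a' b' c' d' =
  mx2 (a * a' + b * c') (a * b' + b * d') (c * a' + d * c') (c * b' + d * d').
Proof.
apply/matrixP => i j; rewrite !mxE sum2 !mxE.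
by case: (ord2P i) => ->; case: (ord2P j) => ->.
Qed.
Lemma mul_rw a b a' b' c' d' : rw a b *m mx2 a' b' c' d' =
  rw (a * a' + b * c') (a * b' + b * d').
Proof.
by apply/rowP => j; rewrite !mxE sum2 !mxE; case: (ord2P j) => ->.
Qed.
Lemma scale_rw k a b : k *: rw a b = rw (k * a) (k * b).
Proof. by apply/rowP => j; rewrite !mxE; case: eqP. Qed.
Lemma mx2_1 : 1%:M = mx2 1 0 0 1.
Proof.
by apply/matrixP => i j; rewrite !mxE; case: (ord2P i) => ->;
  case: (ord2P j) => ->.
Qed.
Lemma rw_inj a b c d : rw a b = rw c d -> a = c /\ b = d.
Proof.
by move=> /rowP e; have := e 0; have := e 1; rewrite !mxE.
Qed.
Lemma mx2_inj a b c d a' b' c' d' : mx2 a b c d = mx2 a' b' c' d' ->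
  [/\ a = a', b = b', c = c' & d = d'].
Proof.
move=> /matrixP e; have := e 0 0; have := e 0 1; have := e 1 0; have := e 1 1.
by rewrite !mxE.
Qed.

Definition inverse_mx (M N : 'M[R]_2) := M *m N = 1%:M /\ N *m M = 1%:M.

Lemma inverse_mxM M N M' N' : inverse_mx M N -> inverse_mx M' N' ->
  inverse_mx (M *m M') (N' *m N).
Proof.
move=> [MN NM] [MN' NM']; split.
  by rewrite mulmxA -(mulmxA M) MN' mulmx1.
by rewrite mulmxA -(mulmxA N') NM mulmx1.
Qed.

(** In a noncommutative ring an invertible triangular matrix may have non-unit diagonal entries.
    Here the unit [a] makes the upper right entry of the inverse vanish, and then its lower right
    entry inverts [d]. *)
Lemma GL2_lower a c d : unit_elt a -> GL2 R (mx2 a 0 c d) <-> unit_elt d.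
Proof.
move=> [a' [aa a'a]]; split=> [[N [MN NM]]|[d' [dd d'd]]].
  move: MN NM; rewrite (mx2E N) !mul_mx2 mx2_1 =>
    /mx2_inj[_ ay _ e1] /mx2_inj[_ e2 _ e3].
  move: ay; rewrite mul0r addr0 => ay.
  have y0 : N 0 1 = 0 by rewrite -[N 0 1]mul1r -a'a -mulrA ay mulr0.
  by exists (N 1 1); move: e1 e3; rewrite y0 !mulr0 !add0r.
exists (mx2 a' 0 (- (d' * c * a')) d'); rewrite !mul_mx2 mx2_1.
rewrite !mul0r !mulr0 !addr0 !add0r aa a'a dd d'd mulrN !mulrA dd mul1r subrr.
by rewrite mulNr -!mulrA a'a mulr1 addNr.
Qed.

Lemma row_invertible M N : inverse_mx M N -> row 0 M *m N = rw 1 0.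
Proof.
by move=> [MN _]; rewrite -row_mul MN; apply/rowP => j; rewrite !mxE;
  case: (ord2P j) => ->.
Qed.
Lemma row1_invertible M N : inverse_mx M N -> row 1 M *m N = rw 0 1.
Proof.
by move=> [MN _]; rewrite -row_mul MN; apply/rowP => j; rewrite !mxE;
  case: (ord2P j) => ->.
Qed.

(** The right inverse column allows scalars to be cancelled from [c *: Q]; without it two generators
    of one cyclic submodule need not differ by a unit. *)
Definition unimodular (Q : 'rV[R]_2) := exists n : 'cV[R]_2, Q *m n = 1%:M.

Lemma unimodular_row i M : GL2 R M -> unimodular (row i M).
Proof.
move=> [N [MN _]]; exists (col i N).
apply/matrixP => j k; rewrite !ord1 [RHS]mxE eqxx.
transitivity ((M *m N) i i); last by rewrite MN mxE eqxx.
by rewrite !mxE; apply: eq_bigr => l _; rewrite !mxE.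
Qed.

Lemma unimodular_scale P Q c d : unimodular P -> unimodular Q ->
  P = c *: Q -> Q = d *: P -> c * d = 1 /\ d * c = 1.
Proof.
move=> [m Pm] [n Qn] PQ QP; split.
  have : (c * d) *: P = P by rewrite -scalerA -QP -PQ.
  move=> /(congr1 (mulmx^~ m)); rewrite -scalemxAl Pm => /matrixP/(_ 0 0).
  by rewrite !mxE eqxx mulr1.
have : (d * c) *: Q = Q by rewrite -scalerA -PQ -QP.
move=> /(congr1 (mulmx^~ n)); rewrite -scalemxAl Qn => /matrixP/(_ 0 0).
by rewrite !mxE eqxx mulr1.
Qed.

Lemma cyclic_eq_unit P Q : unimodular P -> unimodular Q ->
  cyclic_submod P = cyclic_submod Q -> exists2 c, unit_elt c & P = c *: Q.
Proof.
move=> uP uQ e; have [c cE] := cyclic_mem e; have [d dE] := cyclic_mem (esym e).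
by exists c => //; exists d; apply: unimodular_scale cE dE.
Qed.

Lemma cyclic_unit (P : 'rV[R]_2) c :
  unit_elt c -> cyclic_submod (c *: P) = cyclic_submod P.
Proof.
move=> [d [_ dc]]; apply: (@cyclic_eq _ _ _ c d) => //.
by rewrite scalerA dc scale1r.
Qed.

(** Multiplying by [N] moves p to R(1,0), and a row completes (1,0) to an invertible matrix exactly
    when its second entry is a unit, by [GL2_lower]. Distance becomes a single unit test on any
    chosen generators. *)
Lemma distant_frame p q M N Q : inverse_mx M N ->
    val p = cyclic_submod (row 0 M) -> unimodular Q ->
      val q = cyclic_submod Q ->
  distant p q <-> unit_elt ((Q *m N) 0 1).
Proof.
move=> MN pM uQ qQ; have MG : GL2 R M by exists N.
have NG : GL2 R N by exists M; case: MN.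
split=> [[M' MG' [pM' qM']]|f1].
  have [c cu cE] : exists2 c, unit_elt c & row 0 M' = c *: row 0 M.
    by apply: cyclic_eq_unit; rewrite -?pM' //; exact: unimodular_row.
  have [d du dE] : exists2 d, unit_elt d & Q = d *: row 1 M'.
    by apply: cyclic_eq_unit; rewrite -?qQ //; exact: unimodular_row.
  have [N' MN'] := MG'.
  have : GL2 R (M' *m N).
    by exists (M *m N'); apply: inverse_mxM => //; case: MN.
  have -> : M' *m N = mx2 c 0 ((M' *m N) 1 0) ((M' *m N) 1 1).
    rewrite [LHS]mx2E; have := row_invertible MN.
    move=> /(congr1 (fun v => c *: v));
      rewrite scalemxAl -cE scale_rw mulr1 mulr0 -row_mul => e.
    have := congr1 (fun v : 'rV_2 => v 0 0) e;
      have := congr1 (fun v : 'rV_2 => v 0 1) e.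
    by rewrite mxE [RHS]mxE => -> /=; rewrite mxE [RHS]mxE => ->.
  move/(GL2_lower _ _ cu); have -> : (Q *m N) 0 1 = d * (M' *m N) 1 1.
    by rewrite dE -scalemxAl -row_mul [LHS]mxE [in LHS]mxE.
  exact: unit_eltM.
exists (mx2 1 0 ((Q *m N) 0 0) ((Q *m N) 0 1) *m M).
  have [N' MN'] := (GL2_lower ((Q *m N) 0 0) ((Q *m N) 0 1) unit_elt1).2 f1.
  by exists (N *m N'); exact: inverse_mxM.
rewrite !row_mul row0_mx2 row1_mx2 -rwE -mulmxA; split.
  by rewrite -(row_invertible MN) -mulmxA (proj2 MN) mulmx1.
by rewrite (proj2 MN) mulmx1.
Qed.

Lemma distant_sym p q : distant p q -> distant q p.
Proof.
move=> [M [N MN] [pM qM]].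
pose X := mx2 0 1 1 0.
have XX : inverse_mx X X.
  by split; rewrite /X mul_mx2 mx2_1 !(mul0r, mulr0, mulr1, add0r, addr0).
exists (X *m M); first by exists (N *m X); exact: inverse_mxM.
rewrite !row_mul /X row0_mx2 row1_mx2 pM qM; split; congr cyclic_submod.
  by rewrite [M]mx2E row1_mx2 mul_rw !(mul0r, mul1r, add0r, addr0).
by rewrite [M]mx2E row0_mx2 mul_rw !(mul0r, mul1r, add0r, addr0).
Qed.

Lemma shear_inverse x : inverse_mx (mx2 x 1 (-1) 0) (mx2 0 (-1) 1 x).
Proof.
split; rewrite mul_mx2 mx2_1 !(mul0r, mulr0, mulr1, mul1r, add0r, addr0, mulrN,
  mulNr, opprK, oppr0).
  by rewrite addNr.
by rewrite subrr.
Qed.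

Lemma diag_inverse a b a' b' : a * a' = 1 -> a' * a = 1 -> b * b' = 1 ->
  b' * b = 1 -> inverse_mx (mx2 a 0 0 b) (mx2 a' 0 0 b').
Proof.
move=> h1 h2 h3 h4.
by split; rewrite mul_mx2 mx2_1 !(mul0r, mulr0, add0r, addr0) ?h1 ?h2 ?h3 ?h4.
Qed.

Lemma inverse_mx1 : inverse_mx 1%:M 1%:M.
Proof. by split; rewrite mulmx1. Qed.

Lemma inverse_mx_sym M N : inverse_mx M N -> inverse_mx N M.
Proof. by case. Qed.

Lemma unimodular_affine x : unimodular (rw x 1).
Proof.
by rewrite -(row0_mx2 x 1 (-1) 0); apply: unimodular_row;
  exists (mx2 0 (-1) 1 x);
  exact: shear_inverse.
Qed.

Lemma point_exists M N : inverse_mx M N ->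
  {p : proj_line R | val p = cyclic_submod (row 0 M)}.
Proof.
move=> MN; suff h : cyclic_submod (row 0 M) \in proj_line R by exists (SigSub
  h).
by apply/mem_set; exists M => //; exists N.
Qed.

(** The affine chart of points R(x,1), which are the points distant to [pt_inf]. *)
Definition pt x : proj_line R := sval (point_exists (shear_inverse x)).
Lemma ptE x : val (pt x) = cyclic_submod (rw x 1).
Proof. by rewrite (svalP (point_exists (shear_inverse x))) row0_mx2. Qed.

Definition pt_inf : proj_line R := sval (point_exists inverse_mx1).
Lemma infE : val pt_inf = cyclic_submod (rw 1 0).
Proof. by rewrite (svalP (point_exists inverse_mx1)) mx2_1 row0_mx2. Qed.

Lemma pt_distant x q Q : unimodular Q -> val q = cyclic_submod Q ->
  distant (pt x) q <-> unit_elt (Q 0 0 - Q 0 1 * x).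
Proof.
move=> uQ qQ; have := ptE x; rewrite -(row0_mx2 x 1 (-1) 0) => e.
rewrite (distant_frame (shear_inverse x) e uQ qQ) {1}[Q]rwE mul_rw mxE /=.
by rewrite mulrN1 -unit_eltN opprD opprK.
Qed.

Lemma pt_pt_distant x y : distant (pt x) (pt y) <-> unit_elt (y - x).
Proof.
by rewrite (pt_distant x (unimodular_affine y) (ptE y)) !mxE /= mul1r.
Qed.

Lemma inf_distant q Q : unimodular Q -> val q = cyclic_submod Q ->
  distant pt_inf q <-> unit_elt (Q 0 1).
Proof.
move=> uQ qQ; have e : val pt_inf = cyclic_submod (row 0 1%:M).
  by rewrite infE mx2_1 row0_mx2.
by rewrite (distant_frame inverse_mx1 e uQ qQ) mulmx1.
Qed.

Lemma inf_pt_distant x : distant pt_inf (pt x).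
Proof.
by apply/(inf_distant (unimodular_affine x) (ptE x)); rewrite !mxE;
  exact: unit_elt1.
Qed.

Lemma point_frame p : exists M N,
  inverse_mx M N /\ val p = cyclic_submod (row 0 M).
Proof. by have [[M N] [/= MN NM pM]] := frame_exists p; exists M, N. Qed.

Lemma distant_inf_pt q : distant pt_inf q -> exists x, q = pt x.
Proof.
have [M [N [MN qM]]] := point_frame q.
have uM : unimodular (row 0 M) by apply: unimodular_row; exists N.
move=> /(inf_distant uM qM)[d [cd dc]].
exists (d * row 0 M 0 0); apply: val_inj; rewrite ptE qM.
have dU : unit_elt d by exists (row 0 M 0 1).
by rewrite -(cyclic_unit _ dU) [row 0 M in LHS]rwE scale_rw dc.
Qed.

Lemma pt_inj x y : pt x = pt y -> x = y.
Proof.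
move=> /(congr1 val); rewrite !ptE => /cyclic_mem[c].
by rewrite scale_rw mulr1 => /rw_inj[-> <-]; rewrite mul1r.
Qed.

(* The third point is any point of the projective line, not only of the affine
   chart: over the field with two elements no affine point would do. *)
Definition adjacent p q := p <> q /\ exists t, [/\ t <> p, t <> q &
  forall s, distant s t -> distant s p \/ distant s q].

End TwoByTwo.

Section DistIso.
Variables (R R' : pzRingType).

Lemma dist_isomorphism_adj (phi : proj_line R -> proj_line R') :
  dist_isomorphism phi -> forall p q, adjacent p q <-> adjacent (phi p) (phi q).
Proof.
move=> [[psi phiK psiK] phiD] p q.
have inj := can_inj phiK.
split=> [[pq [c [cp cq cs]]]|[pq [c [cp cq cs]]]].
  split; first by move/inj.
  exists (phi c); split; [by move/inj|by move/inj|move=> s].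
  by rewrite -(psiK s) -!phiD; exact: cs.
split; first by move=> e; apply: pq; rewrite e.
exists (psi c); split; [by move=> e; apply: cp; rewrite -e psiK|
  by move=> e; apply: cq; rewrite -e psiK|move=> s].
by rewrite !phiD psiK; exact: cs.
Qed.

Lemma dist_isomorphism_inv (phi : proj_line R -> proj_line R') psi :
  cancel phi psi -> cancel psi phi -> dist_isomorphism phi ->
    dist_isomorphism psi.
Proof.
move=> phiK psiK [_ phiD]; split; first by exists phi.
by move=> p q; rewrite phiD !psiK.
Qed.

End DistIso.

Lemma dist_isomorphism_comp (R R' R'' : pzRingType)
    (phi : proj_line R -> proj_line R') (psi : proj_line R' -> proj_line R'') :
  dist_isomorphism phi -> dist_isomorphism psi -> dist_isomorphism (psi \o phi).
Proof.
move=> [b1 h1] [b2 h2]; split; first exact: bij_comp.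
by move=> p q; rewrite h1 h2.
Qed.

(** * Projectivities of the line *)

Section Projectivities.
Variable R : pzRingType.

Lemma projectivityE' (gamma : GL2 R) (p : proj_line R) M N : inverse_mx M N ->
  val p = cyclic_submod (row 0 M) ->
  val (projectivity gamma p) = cyclic_submod (row 0 (M *m val gamma)).
Proof. by move=> MN pM; rewrite (projectivityE gamma (M := M)) ?row_mul //;
  exists N. Qed.

Lemma projectivityK (gamma delta : GL2 R) : inverse_mx (val gamma) (val delta)
  ->
  cancel (projectivity gamma) (projectivity delta).
Proof.
move=> gd p; apply: val_inj; have [M [N [MN pM]]] := point_frame p.
rewrite (projectivityE' delta (inverse_mxM MN gd) (projectivityE' gamma MN pM)).
by rewrite -mulmxA (proj1 gd) mulmx1.
Qed.

Lemma GL2_inverse (gamma : GL2 R) : exists delta : GL2 R,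
  inverse_mx (val gamma) (val delta).
Proof.
case: gamma => G /= /set_mem[H [GH HG]].
have HR : H \in GL2 R by apply/mem_set; exists G.
by exists (SigSub HR).
Qed.

Lemma projectivity_dist (gamma : GL2 R) : dist_isomorphism (projectivity gamma).
Proof.
have [delta gd] := GL2_inverse gamma; split.
  exists (projectivity delta); apply: projectivityK => //;
    exact: inverse_mx_sym.
move=> p q; have [M [N [MN pM]]] := point_frame p.
have [M' [N' [MN' qM']]] := point_frame q.
have uM' : unimodular (row 0 M') by apply: unimodular_row; exists N'.
have MN'g := inverse_mxM MN' gd.
have uMg : unimodular (row 0 (M' *m val gamma)).
  by apply: unimodular_row; exists (val delta *m N').
rewrite (distant_frame MN pM uM' qM').
rewrite (distant_frame (inverse_mxM MN gd) (projectivityE' gamma MN pM) uMg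
  (projectivityE' gamma MN' qM')).
by rewrite row_mul mulmxA -(mulmxA (row 0 M')) (proj1 gd) mulmx1.
Qed.
End Projectivities.

(** * Maps induced by homomorphisms and anti-homomorphisms *)

Section HomAnti.
Variables (R R' : pzRingType).

Lemma unit_elt_morph (al : R -> R') : bijective al -> al 1 = 1 ->
  ({morph al : x y / x * y} \/ (forall x y, al (x * y) = al y * al x)) ->
  forall x, unit_elt (al x) <-> unit_elt x.
Proof.
move=> [be alK beK] al1 alM x; have inj := can_inj alK.
split=> [[y]|[y [xy yx]]].
  rewrite -(beK y) -al1; case: alM => alM; rewrite -!alM => -[/inj e1 /inj e2];
  by exists (be y).
by exists (al y); case: alM => alM; rewrite -!alM xy yx.
Qed.

Lemma hom_tilde_pt (al : {rmorphism R ->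
  R'}) x : hom_tilde al (pt x) = pt (al x).
Proof.
apply: val_inj; rewrite ptE (hom_tildeE al (M := mx2 x 1 (-1) 0)).
- by congr cyclic_submod; apply/rowP => j; rewrite !mxE;
  case: (ord2P j) => -> //=; rewrite rmorph1.
- by exists (mx2 0 (-1) 1 x); exact: shear_inverse.
- by rewrite ptE row0_mx2.
Qed.

Lemma map_inverse_mx (al : {rmorphism R -> R'}) M N : inverse_mx M N ->
  inverse_mx (map_mx al M) (map_mx al N).
Proof. by move=> [MN NM]; split; rewrite -map_mxM ?MN ?NM map_mx1. Qed.

Lemma hom_tilde_dist (al : {rmorphism R -> R'}) : bijective al ->
  forall p q, distant p q <-> distant (hom_tilde al p) (hom_tilde al q).
Proof.
move=> alb p q; have [M [N [MN pM]]] := point_frame p.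
have [M' [N' [MN' qM']]] := point_frame q.
have MG : GL2 R M by exists N. have MG' : GL2 R M' by exists N'.
have := hom_tildeE al MG pM; have := hom_tildeE al MG' qM';
  rewrite !map_row => e2 e1.
have uM : unimodular (row 0 (map_mx al M')).
  by apply: unimodular_row; exists (map_mx al N'); exact: map_inverse_mx.
rewrite (distant_frame MN pM (unimodular_row _ MG') qM').
rewrite (distant_frame (map_inverse_mx al MN) e1 uM e2) -map_row -map_mxM [X in
  _ <-> unit_elt X]mxE.
rewrite unit_elt_morph //; first exact: rmorph1.
by left; exact: rmorphM.
Qed.

Variable al : {rmorphism R^c -> R'}.
Let alD (x y : R) : al (x + y) = al x + al y.
Proof. exact: rmorphD. Qed.
Let alN (x : R) : al (- x) = - al x.
Proof. exact: rmorphN. Qed.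
Let alM (x y : R) : al (x * y) = al y * al x.
Proof. exact: (rmorphM al (y : R^c) (x : R^c)). Qed.
Let al1 : al (1 : R) = 1.
Proof. exact: (rmorph1 al). Qed.
Let al0 : al (0 : R) = 0.
Proof. exact: (rmorph0 al). Qed.

Lemma anti_tilde_pt (x : R) : anti_tilde al (pt x) = pt (al x).
Proof.
have [sh1 sh2] := shear_inverse x.
apply: val_inj; rewrite ptE (anti_tildeE al sh1 sh2);
  last by rewrite ptE row0_mx2.
have u : unit_elt (-1 : R') by apply/unit_eltN; exact: unit_elt1.
rewrite -(cyclic_unit _ u); congr cyclic_submod; apply/rowP => j; rewrite !mxE.
by case: (ord2P j) => -> /=; rewrite ?alN ?al1 mulN1r opprK.
Qed.

(** Applying [al] to the entries and transposing reverses matrix products; exchanging the two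
    coordinates and adjusting signs then puts [anti_row al N] on top. *)
Definition anti_mx (N : 'M[R]_2) : 'M[R']_2 :=
  mx2 (- al (N 1 1)) (al (N 0 1)) (al (N 1 0)) (- al (N 0 0)).

Lemma anti_mx_inverse M N : inverse_mx M N ->
  inverse_mx (anti_mx N) (anti_mx M).
Proof.
have main (A B : 'M[R]_2) : A *m B = 1%:M -> anti_mx B *m anti_mx A = 1%:M.
  rewrite {1}[A]mx2E {1}[B]mx2E mul_mx2 !mx2_1 => /mx2_inj[e1 e2 e3 e4].
  rewrite /anti_mx mul_mx2 !mulrNN !(mulrN, mulNr) -!alM -!alD -!opprD -!alD.
  by rewrite ![A 1 1 * _ + _]addrC ![A 0 1 * _ + _]addrC e1 e2 e3 e4 al0 al1
    oppr0.
by move=> [MN NM]; split; exact: main.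
Qed.

Lemma anti_row_mx N : anti_row al N = row 0 (anti_mx N).
Proof. by rewrite row0_mx2; apply/rowP => j; rewrite !mxE. Qed.

Lemma anti_tilde_dist : bijective al ->
  forall p q, distant p q <-> distant (anti_tilde al p) (anti_tilde al q).
Proof.
move=> alb p q; have [M [N [MN pM]]] := point_frame p.
have [M' [N' [MN' qM']]] := point_frame q.
have := anti_tildeE al (proj1 MN) (proj2 MN) pM.
have := anti_tildeE al (proj1 MN') (proj2 MN') qM';
  rewrite !anti_row_mx => e2 e1.
have uM : unimodular (row 0 (anti_mx N')).
  by apply: unimodular_row; exists (anti_mx M'); exact: anti_mx_inverse.
rewrite (distant_frame (anti_mx_inverse MN) e1 uM e2).
have uM0 : unimodular (row 0 M) by apply: unimodular_row; exists N.
(* The two points come out in reversed roles: the entry tests the distance from q to p, hence the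
   appeal to [distant_sym]. *)
have -> : (row 0 (anti_mx N') *m anti_mx M) 0 1 = - al ((row 0 M *m N') 0 1).
  rewrite [LHS]mxE sum2 [X in _ = - al X]mxE sum2 /anti_mx.
  by rewrite !mxE /= alD opprD !alM mulNr mulrN addrC.
rewrite unit_eltN unit_elt_morph //; last by right.
rewrite -(distant_frame MN' qM' uM0 pM).
by split; exact: distant_sym.
Qed.
End HomAnti.

Lemma projectivity_gen (R : pzRingType) (gamma : GL2 R) (p : proj_line R) Q :
  val p = cyclic_submod Q ->
  val (projectivity gamma p) = cyclic_submod (Q *m val gamma).
Proof.
move=> pQ; have [M [N [MN pM]]] := point_frame p.
rewrite (projectivityE' gamma MN pM) row_mul.
have e := etrans (esym pM) pQ.
have [c cE] := cyclic_mem e; have [d dE] := cyclic_mem (esym e).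
by apply: (@cyclic_eq _ _ _ c d); rewrite scalemxAl -?cE -?dE.
Qed.

Lemma inverse_mx_GL2 (R : pzRingType) M N : inverse_mx M N ->
  exists gamma : GL2 R, val gamma = M.
Proof.
move=> MN; suff MG : M \in GL2 R by exists (SigSub MG).
by apply/mem_set; exists N.
Qed.

Lemma projectivity_comp (R : pzRingType) (gamma delta : GL2 R) :
  exists eps : GL2 R, projectivity eps =1 projectivity delta \o projectivity
    gamma.
Proof.
have [gamma' gg] := GL2_inverse gamma; have [delta' dd] := GL2_inverse delta.
have [eps eE] := inverse_mx_GL2 (inverse_mxM gg dd); exists eps => p /=.
have [M [N [_ pM]]] := point_frame p; apply: val_inj.
rewrite (projectivity_gen eps pM).
by rewrite (projectivity_gen delta (projectivity_gen gamma pM)) eE mulmxA.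
Qed.

Lemma normalize_triple (R : pzRingType) (p q r : proj_line R) :
  distant p q -> distant p r -> distant q r ->
  exists gamma : GL2 R, [/\ projectivity gamma p = pt_inf R,
    projectivity gamma q = pt 0 & projectivity gamma r = pt 1].
Proof.
move=> [M [N MN] [pM qM]] pr qr.
have [delta dN] := inverse_mx_GL2 (inverse_mx_sym MN).
have [_ dD] := projectivity_dist delta.
have dp : projectivity delta p = pt_inf R.
  apply: val_inj; rewrite infE (projectivity_gen delta pM) dN.
  by rewrite (row_invertible MN).
have dq : projectivity delta q = pt 0.
  apply: val_inj; rewrite ptE (projectivity_gen delta qM) dN.
  by rewrite (row1_invertible MN).
(* Being distant to p and q, r becomes R(a,1) with a unit [a]; the diagonal matrix with entries [b],
   the inverse of [a], and 1 sends it to R(1,1) and fixes the other two points. *)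
have [a ra] : exists a, projectivity delta r = pt a.
  by apply: distant_inf_pt; rewrite -dp -dD.
have [b [ab ba]] : unit_elt a.
  by rewrite -[a]subr0 -pt_pt_distant -dq -ra -dD.
have one1 : 1 * 1 = 1 :> R by rewrite mulr1.
have DI := diag_inverse ba ab one1 one1.
have [eps eE] := inverse_mx_GL2 DI.
have [gamma gE] := projectivity_comp delta eps.
have uU c : c * a = 1 -> a * c = 1 -> unit_elt c by move=> h1 h2; exists a.
exists gamma; split; rewrite gE /=.
- rewrite dp; apply: val_inj; rewrite (projectivity_gen eps (infE R)) eE infE.
  rewrite mul_rw !(mul1r, mul0r, mulr0,
    addr0) -[RHS](cyclic_unit _ (uU _ ba ab)).
  by rewrite scale_rw mulr1 mulr0.
- rewrite dq; apply: val_inj; rewrite (projectivity_gen eps (ptE 0)) eE ptE.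
  by rewrite mul_rw !(mul1r, mul0r, mulr0, addr0, add0r).
- rewrite ra; apply: val_inj; rewrite (projectivity_gen eps (ptE a)) eE ptE.
  by rewrite mul_rw !(mul1r, mul0r, mulr0, addr0, add0r) ab.
Qed.

Lemma affine_part (R R' : pzRingType) (phi : proj_line R -> proj_line R') :
    dist_isomorphism phi -> phi (pt_inf R) = pt_inf R' ->
    phi (pt 0) = pt 0 -> phi (pt 1) = pt 1 ->
  exists f : R -> R', [/\ forall x, phi (pt x) = pt (f x), bijective f, f 0 = 0,
    f 1 = 1 & forall x y, unit_elt (y - x) <-> unit_elt (f y - f x)].
Proof.
move=> phiI phi_inf phi0 phi1; have [[psi phiK psiK] phiD] := phiI.
have /choice[f fE] x : exists y, phi (pt x) = pt y.
  by apply: distant_inf_pt; rewrite -phi_inf -phiD; exact: inf_pt_distant.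
have /choice[g gE] y : exists x, psi (pt y) = pt x.
  by apply: distant_inf_pt; rewrite phiD psiK phi_inf; exact: inf_pt_distant.
exists f; split=> //.
- exists g => x; apply: (@pt_inj _); first by rewrite -gE -fE phiK.
  by rewrite -fE -gE psiK.
- by apply: (@pt_inj _); rewrite -fE.
- by apply: (@pt_inj _); rewrite -fE.
- by move=> x y; rewrite -!pt_pt_distant -!fE; exact: phiD.
Qed.

(** * Bijections preserving adjacency of tensors *)

(* A dual pair (U, D) over K together with the additive group R of finite-rank
   endomorphisms of U.  D is a right K-space, but only its scaling map [rscale]
   is recorded, so that both (U, dual U) over K and (dual U, U) over K^c are
   instances with R = endo U; [ev x] is [x], resp. its transpose. *)
Record dual_tensor (K : unitRingType) (U : lmodType K) (D R : zmodType) :=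
  DualTensor {
  rscale : D -> K -> D;
  pr : U -> D -> K;
  tn : D -> U -> R;
  ev : R -> U -> U;
  prDl : forall u v r, pr (u + v) r = pr u r + pr v r;
  prDr : forall u r s, pr u (r + s) = pr u r + pr u s;
  prZl : forall k u r, pr (k *: u) r = k * pr u r;
  prZr : forall u r k, pr u (rscale r k) = pr u r * k;
  pr_eq0l : forall u, (forall r, pr u r = 0) -> u = 0;
  pr_eq0r : forall r, (forall u, pr u r = 0) -> r = 0;
  evD : forall x y z, ev (x + y) z = ev x z + ev y z;
  ev_inj : forall x y, (forall z, ev x z = ev y z) -> x = y;
  ev_tn : forall r u z, ev (tn r u) z = pr z r *: u;
  tn_ind : forall P : R -> Prop,
    P 0 -> (forall a r u, P a -> P (a + tn r u)) -> forall a, P a;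
  two_vectors : exists u v : U, u <> 0 /\ forall k, v <> k *: u
}.

Section DualTensor.
Variables (K : unitRingType) (fieldK : GRing.field_axiom K).
Variables (U : lmodType K) (D R : zmodType) (S : dual_tensor U D R).
Local Notation rs := (rscale S).
Local Notation "r ** u" := (tn S r u) (at level 38).
Local Notation pr := (pr S).
Local Notation ev := (ev S).
Implicit Types (u v w z : U) (r s t p q : D) (k l : K) (a b x y : R).

Lemma fmulVr k : k <> 0 -> k^-1 * k = 1.
Proof. by move=> /eqP/fieldK; exact: mulVr. Qed.
Lemma fmulrV k : k <> 0 -> k * k^-1 = 1.
Proof. by move=> /eqP/fieldK; exact: mulrV. Qed.
Lemma finv_neq0 k : k <> 0 -> k^-1 <> 0.
Proof.
by move=> /fmulVr kk k0; move: kk; rewrite k0 mul0r => /eqP;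
  rewrite eq_sym oner_eq0.
Qed.
Lemma pr0l r : pr 0 r = 0.
Proof. by have := prDl S 0 0 r; rewrite addr0 -{1}[pr 0 r]addr0 => /addrI. Qed.
Lemma pr0r u : pr u 0 = 0.
Proof. by have := prDr S u 0 0; rewrite addr0 -{1}[pr u 0]addr0 => /addrI. Qed.
Lemma prNl u r : pr (- u) r = - pr u r.
Proof. by apply/eqP; rewrite -addr_eq0 -prDl addNr pr0l. Qed.
Lemma prNr u r : pr u (- r) = - pr u r.
Proof. by apply/eqP; rewrite -addr_eq0 -prDr addNr pr0r. Qed.
Lemma prBr u r s : pr u (r - s) = pr u r - pr u s.
Proof. by rewrite prDr prNr. Qed.
Lemma pr_extl u v : (forall r, pr u r = pr v r) -> u = v.
Proof.
move=> uv; apply/eqP; rewrite -subr_eq0; apply/eqP/(pr_eq0l (d:=S)) => r.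
by rewrite prDl prNl uv subrr.
Qed.
Lemma pr_extr r s : (forall u, pr u r = pr u s) -> r = s.
Proof.
move=> rs; apply/eqP; rewrite -subr_eq0; apply/eqP/(pr_eq0r (d:=S)) => u.
by rewrite prBr rs subrr.
Qed.
Lemma ev0 z : ev 0 z = 0.
Proof. by have := evD S 0 0 z; rewrite addr0 -{1}[ev 0 z]addr0 => /addrI. Qed.
Lemma evN x z : ev (- x) z = - ev x z.
Proof. by apply/eqP; rewrite -addr_eq0 -evD addNr ev0. Qed.

Definition evE := (evD S, evN, ev0, ev_tn S).
Definition prE := (prDl S, prDr S, prZl S, prZr S, prNl, prNr, pr0l, pr0r).

Lemma rs0 r : rs r 0 = 0.
Proof. by apply: pr_extr => u; rewrite !prE mulr0. Qed.
Lemma rsA r k l : rs (rs r k) l = rs r (k * l).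
Proof. by apply: pr_extr => u; rewrite !prE mulrA. Qed.
Lemma rs1 r : rs r 1 = r.
Proof. by apply: pr_extr => u; rewrite !prE mulr1. Qed.

Lemma tnDl r s u : (r + s) ** u = r ** u + s ** u.
Proof. by apply: (ev_inj (d:=S)) => z; rewrite !evE !prE scalerDl. Qed.
Lemma tnDr r u v : r ** (u + v) = r ** u + r ** v.
Proof. by apply: (ev_inj (d:=S)) => z; rewrite !evE scalerDr. Qed.
Lemma tn0l u : 0 ** u = 0.
Proof. by apply: (ev_inj (d:=S)) => z; rewrite !evE !prE scale0r. Qed.
Lemma tn0r r : r ** 0 = 0.
Proof. by apply: (ev_inj (d:=S)) => z; rewrite !evE scaler0. Qed.
Lemma tnNl r u : (- r) ** u = - (r ** u).
Proof. by apply: (ev_inj (d:=S)) => z; rewrite !evE !prE scaleNr. Qed.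
Lemma tnNr r u : r ** (- u) = - (r ** u).
Proof. by apply: (ev_inj (d:=S)) => z; rewrite !evE scalerN. Qed.
Lemma tnZ r k u : rs r k ** u = r ** (k *: u).
Proof. by apply: (ev_inj (d:=S)) => z; rewrite !evE !prE scalerA. Qed.

Lemma scale_cancel k u v : k <> 0 -> k *: u = v -> u = k^-1 *: v.
Proof. by move=> k0 <-; rewrite scalerA fmulVr // scale1r. Qed.
Lemma rs_cancel k r s : k <> 0 -> rs r k = s -> r = rs s k^-1.
Proof. by move=> k0 <-; rewrite rsA fmulrV // rs1. Qed.

Lemma sep1 r : r <> 0 -> exists z, pr z r = 1.
Proof.
move=> r0; have [u ur] : exists u, pr u r <> 0.
  by apply: contrapT => h; apply: r0; apply: (pr_eq0r (d:=S)) => u;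
    apply: contrapT => hu; apply: h; exists u.
by exists ((pr u r)^-1 *: u); rewrite prE fmulVr.
Qed.

(** Elimination: [p - rs q (pr z0 p)] vanishes at [z0], so subtracting a multiple of [z0] to kill
    [q] keeps its value 1, and once [q] is killed this is the value of [p]. *)
Lemma sep2 p q : (forall k, p <> rs q k) ->
  exists z, pr z p = 1 /\ pr z q = 0.
Proof.
move=> pq; case: (EM (q = 0)) => [->|/sep1 [z0 z0q]].
  have [|z zp] := @sep1 p; first by move=> p0; apply: (pq 0); rewrite rs0.
  by exists z; rewrite pr0r.
have [|z1 z1p] := @sep1 (p - rs q (pr z0 p)).
  by move/eqP; rewrite subr_eq0 => /eqP; exact: pq.
exists (z1 - pr z1 q *: z0); move: z1p; rewrite !prE z0q mulr1 subrr => z1p.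
by split=> //; rewrite -mulNr mulNr.
Qed.

Lemma sep3 p q s : (forall k, q <> rs s k) ->
  (forall k l, p <> rs q k + rs s l) ->
  exists z, [/\ pr z p = 1, pr z q = 0 & pr z s = 0].
Proof.
move=> /sep2[z0 [z0q z0s]] pqs.
have [|z1 [z1p z1s]] := @sep2 (p - rs q (pr z0 p)) s.
  move=> k /eqP; rewrite subr_eq addrC => /eqP; exact: pqs.
exists (z1 - pr z1 q *: z0); move: z1p; rewrite !prE z0q z0s mulr1 mulr0 subrr.
by rewrite z1s subr0 => z1p.
Qed.

Lemma tn_eq0 r u : r ** u = 0 -> r = 0 \/ u = 0.
Proof.
move=> ru; case: (EM (r = 0)) => [|/sep1[z zr]]; [by left|right].
by have := congr1 (ev^~ z) ru; rewrite !evE zr scale1r.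
Qed.
Lemma tn_neq0 r u : r <> 0 -> u <> 0 -> r ** u <> 0.
Proof. by move=> r0 u0 /tn_eq0 []. Qed.
Lemma tn_injr r u v : r <> 0 -> r ** u = r ** v -> u = v.
Proof.
move=> /sep1[z zr] /(congr1 (ev^~ z)); by rewrite !evE zr !scale1r.
Qed.
Lemma tn_injl r s u : u <> 0 -> r ** u = s ** u -> r = s.
Proof.
move=> u0 e; have : (r - s) ** u = 0 by rewrite tnDl tnNl e subrr.
by case/tn_eq0 => // /eqP; rewrite subr_eq0 => /eqP.
Qed.

Lemma rs_notin p q : p <> 0 -> (forall k, q <> rs p k) -> forall k, p <> rs q k.
Proof.
move=> p0 qp k pqk; case: (EM (k = 0)) => [k0|k0].
  by apply: p0; rewrite pqk k0 rs0.
exact: (qp k^-1) (rs_cancel k0 (esym pqk)).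
Qed.
Lemma scale_notin u v : u <> 0 -> (forall k, v <> k *: u) ->
  forall k, u <> k *: v.
Proof.
move=> u0 vu k uvk; case: (EM (k = 0)) => [k0|k0].
  by apply: u0; rewrite uvk k0 scale0r.
exact: (vu k^-1) (scale_cancel k0 (esym uvk)).
Qed.

Lemma scale_common u v w k l : u <> 0 -> u = k *: w -> v = l *: w ->
  exists m, v = m *: u.
Proof.
move=> u0 ukw ->; case: (EM (k = 0)) => [k0|k0].
  by case: u0; rewrite ukw k0 scale0r.
by exists (l * k^-1); rewrite (scale_cancel k0 (esym ukw)) scalerA.
Qed.
Lemma rs_common p q r k l : p <> 0 -> p = rs r k -> q = rs r l ->
  exists m, q = rs p m.
Proof.
move=> p0 prk ->; case: (EM (k = 0)) => [k0|k0].
  by case: p0; rewrite prk k0 rs0.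
by exists (k^-1 * l); rewrite (rs_cancel k0 (esym prk)) rsA.
Qed.

(* Rank at most one. *)
Definition rk1 x := exists r u, x = r ** u.
(** For [endo_tensor] and nonzero [u], [r] these are minimal one-sided ideals: [Lset u] is the left
    ideal of maps with image in Ku, [Jset r] the right ideal of maps vanishing on the kernel of [r].
    For [endo_cotensor] the roles are exchanged. *)
Definition Lset u x := exists r, x = r ** u.
Definition Jset r x := exists u, x = r ** u.

(** If [r] and [s] are independent, test vectors isolating one form each show that [u] and [v] both
    lie on the line of [w], which contains the image of the difference. *)
Lemma rk1_sub r u s v : r <> 0 -> u <> 0 -> rk1 (r ** u - s ** v) ->
  (exists k, s = rs r k) \/ (exists k, v = k *: u).
Proof.
move=> r0 u0 [t [w e]].
case: (EM (exists k, s = rs r k)) => [|ns]; [by left|right].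
have {}ns k : s <> rs r k by move=> h; apply: ns; exists k.
have nr := rs_notin r0 ns.
have [z [zs zr]] := sep2 ns; have [y [yr ys]] := sep2 nr.
have := congr1 (ev^~ y) e; rewrite !evE yr ys scale0r subr0 scale1r => uw.
have := congr1 (ev^~ z) e; rewrite !evE zs zr scale0r scale1r sub0r => vw.
by apply: (scale_common u0 uw (l := - pr z t)); rewrite scaleNr -vw opprK.
Qed.

(** Test vectors killing [q] isolate [w] and [- v] in the image, and these are independent. The
    vector [y] stays arbitrary because [parallel] has no control over it. *)
Lemma rk1_triple p w s v q (y : U) : (forall k, p <> rs q k) ->
    (forall k l, s <> rs p k + rs q l) -> v <> 0 -> (forall k, w <> k *: v) ->
  ~ rk1 (p ** w - s ** v - q ** y).
Proof.
move=> pq spq v0 wv [t [x e]].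
have sq k : s <> rs q k by move=> h; apply: (spq 0 k); rewrite rs0 add0r.
have psq k l : p <> rs s k + rs q l.
  move=> h; case: (EM (k = 0)) => [k0|k0].
    by apply: (pq l); rewrite h k0 rs0 add0r.
  have /(rs_cancel k0) : rs s k = p - rs q l by rewrite h addrK.
  move=> h2; apply: (spq k^-1 (- (l * k^-1))); rewrite h2.
  by apply: pr_extr => u; rewrite !prE mulrBl mulrN mulrA.
have [z [zp zs zq]] := sep3 sq psq; have [z2 [z2s z2p z2q]] := sep3 pq spq.
have := congr1 (ev^~ z) e.
rewrite !evE zp zs zq !scale0r !subr0 scale1r => wx.
have := congr1 (ev^~ z2) e.
rewrite !evE z2p z2s z2q !scale0r subr0 scale1r sub0r => vx.
have vx' : v = (- pr z2 t) *: x by rewrite scaleNr -vx opprK.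
by have [m] := scale_common v0 vx' wx; exact: wv.
Qed.

Lemma exists_indep u : u <> 0 -> exists v, forall k, v <> k *: u.
Proof.
move=> u0; have [u1 [u2 [u10 u2u1]]] := two_vectors S.
apply: contrapT => h.
have {}h v : exists k, v = k *: u.
  by apply: contrapT => hv; apply: h; exists v => k e; apply: hv; exists k.
have [k1 e1] := h u1; have [k2 e2] := h u2.
by have [m] := scale_common u10 e1 e2; exact: u2u1.
Qed.

Lemma exists_neq0 : exists u, u <> 0.
Proof. by have [u [v []]] := two_vectors S; exists u. Qed.

Lemma sep1l u : u <> 0 -> exists r, pr u r <> 0.
Proof.
move=> u0; apply: contrapT => h; apply: u0; apply: (pr_eq0l (d:=S)) => r.
by apply: contrapT => hr; apply: h; exists r.
Qed.

Lemma exists_neq0_dual : exists r, r <> 0.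
Proof.
have [u /sep1l[r ur]] := exists_neq0; exists r => r0; apply: ur.
by rewrite r0 pr0r.
Qed.

(** Independence is given in [U] only. It yields a nonzero vector in the kernel of [r], and a form
    that does not vanish there is no multiple of [r]. *)
Lemma exists_indep_dual r : r <> 0 -> exists s, forall k, s <> rs r k.
Proof.
move=> r0; have [z zr] := sep1 r0.
have [|v vz] := @exists_indep z.
  by move=> z0; move: zr; rewrite z0 pr0l => /eqP; rewrite eq_sym oner_eq0.
have [|s vs] := @sep1l (v - pr v r *: z).
  by move/eqP; rewrite subr_eq0 => /eqP; exact: vz.
have wr : pr (v - pr v r *: z) r = 0 by rewrite !prE zr mulr1 subrr.
exists (s - rs r (pr z s)) => k /(congr1 (pr (v - pr v r *: z))).
by rewrite prBr !(prZr S) wr !mul0r subr0.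
Qed.

Lemma Lset0 u : Lset u 0. Proof. by exists 0; rewrite tn0l. Qed.
Lemma Jset0 r : Jset r 0. Proof. by exists 0; rewrite tn0r. Qed.
Lemma LsetD u x y : Lset u x -> Lset u y -> Lset u (x + y).
Proof. by move=> [r ->] [s ->]; exists (r + s); rewrite tnDl. Qed.
Lemma JsetD r x y : Jset r x -> Jset r y -> Jset r (x + y).
Proof. by move=> [u ->] [v ->]; exists (u + v); rewrite tnDr. Qed.
Lemma LsetN u x : Lset u x -> Lset u (- x).
Proof. by move=> [r ->]; exists (- r); rewrite tnNl. Qed.
Lemma JsetN r x : Jset r x -> Jset r (- x).
Proof. by move=> [u ->]; exists (- u); rewrite tnNr. Qed.
Lemma LsetDl u x y : Lset u x -> Lset u (x + y) <-> Lset u y.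
Proof.
move=> ux; split=> [h|]; last exact: LsetD.
by rewrite -[y](addKr x); apply: LsetD => //; exact: LsetN.
Qed.
Lemma JsetDl r x y : Jset r x -> Jset r (x + y) <-> Jset r y.
Proof.
move=> ux; split=> [h|]; last exact: JsetD.
by rewrite -[y](addKr x); apply: JsetD => //; exact: JsetN.
Qed.
Lemma Lset_rk1 u x y : Lset u x -> Lset u y -> rk1 (y - x).
Proof.
by move=> [r ->] [s ->]; exists (s - r), u; rewrite tnDl tnNl.
Qed.
Lemma Jset_rk1 r x y : Jset r x -> Jset r y -> rk1 (y - x).
Proof.
by move=> [u ->] [v ->]; exists r, (v - u); rewrite tnDr tnNr.
Qed.

Lemma tn_prop r u s v : r <> 0 -> u <> 0 -> r ** u = s ** v ->
  (exists k, s = rs r k) /\ (exists k, v = k *: u).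
Proof.
move=> r0 u0 e.
have s0 : s <> 0 by move=> s0; move: e; rewrite s0 tn0l; exact: tn_neq0.
have v0 : v <> 0 by move=> v0; move: e; rewrite v0 tn0r; exact: tn_neq0.
have [z zr] := sep1 r0.
have uv : u = pr z s *: v by have := congr1 (ev^~ z) e; rewrite !evE zr scale1r.
have vu : exists k, v = k *: u.
  by apply: (scale_common u0 uv (l := 1)); rewrite scale1r.
split=> //; have [k vk] := vu; move: e; rewrite vk -tnZ => /(tn_injl u0) ->.
case: (EM (k = 0)) => [k0|k0]; first by case: v0; rewrite vk k0 scale0r.
by exists k^-1; rewrite rsA fmulrV // rs1.
Qed.

Lemma LsetZ u v k x : u <> 0 -> u = k *: v -> Lset u x <-> Lset v x.
Proof.
move=> u0 ukv; case: (EM (k = 0)) => [k0|k0].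
  by case: u0; rewrite ukv k0 scale0r.
split=> [[r ->]|[r ->]]; first by exists (rs r k); rewrite tnZ ukv.
by exists (rs r k^-1); rewrite tnZ ukv scalerA fmulVr // scale1r.
Qed.
Lemma JsetZ p q k x : p <> 0 -> p = rs q k -> Jset p x <-> Jset q x.
Proof.
move=> u0 ukv; case: (EM (k = 0)) => [k0|k0].
  by case: u0; rewrite ukv k0 rs0.
split=> [[u ->]|[u ->]]; first by exists (k *: u); rewrite -tnZ ukv.
by exists (k^-1 *: u); rewrite -tnZ ukv rsA fmulrV // rs1.
Qed.

Lemma LsetI u v x : u <> 0 -> v <> 0 -> x <> 0 -> Lset u x -> Lset v x ->
  exists k, v = k *: u.
Proof.
move=> u0 v0 x0 [r e] [s]; rewrite e => e2.
case: (tn_prop _ u0 e2) => // r0.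
by apply: x0; rewrite e r0 tn0l.
Qed.
Lemma JsetI p q x : p <> 0 -> q <> 0 -> x <> 0 -> Jset p x -> Jset q x ->
  exists k, q = rs p k.
Proof.
move=> p0 q0 x0 [u e] [v]; rewrite e => e2.
case: (tn_prop p0 _ e2) => // u0.
by apply: x0; rewrite e u0 tn0r.
Qed.
Lemma LsetE u v x y : u <> 0 -> v <> 0 -> x <> 0 -> Lset u x -> Lset v x ->
  Lset u y <-> Lset v y.
Proof.
move=> u0 v0 x0 ux vx; have [k vk] := LsetI u0 v0 x0 ux vx.
by rewrite (LsetZ y v0 vk).
Qed.
Lemma JsetE p q x y : p <> 0 -> q <> 0 -> x <> 0 -> Jset p x -> Jset q x ->
  Jset p y <-> Jset q y.
Proof.
move=> u0 v0 x0 ux vx; have [k vk] := JsetI u0 v0 x0 ux vx.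
by rewrite (JsetZ y v0 vk).
Qed.

Lemma LJ_notsub u r : u <> 0 -> r <> 0 -> exists x, Lset u x /\ ~ Jset r x.
Proof.
move=> u0 r0; have [s sr] := exists_indep_dual r0.
have s0 : s <> 0 by move=> s0; apply: (sr 0); rewrite rs0.
exists (s ** u); split; [by exists s|move=> [v e]].
have [[k rk] _] := tn_prop s0 u0 e.
exact: rs_notin r0 sr _ rk.
Qed.
Lemma JL_notsub u r : u <> 0 -> r <> 0 -> exists x, Jset r x /\ ~ Lset u x.
Proof.
move=> u0 r0; have [s sr] := exists_indep u0.
have s0 : s <> 0 by move=> s0; apply: (sr 0); rewrite scale0r.
exists (r ** s); split; [by exists s|move=> [v e]].
have [_ [k rk]] := tn_prop r0 s0 e.
exact: scale_notin u0 sr _ rk.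
Qed.

(** Fix a nonzero member [r ** u]. A member outside [Jset r] must be [s ** u] with [s] independent
    of [r]; a nonzero third member outside [Lset u] would need a form proportional to both [r] and
    [s]. *)
Lemma clique_sub (C : R -> Prop) : C 0 -> (forall x y, C x -> C y ->
  rk1 (y - x)) ->
  (exists2 u, u <> 0 & forall x, C x -> Lset u x) \/
  (exists2 r, r <> 0 & forall x, C x -> Jset r x).
Proof.
move=> C0 Cc; case: (EM (exists2 x, C x & x <> 0)) => [[x0 Cx0 x0n]|h];
  last first.
  have [u u0] := exists_neq0; left; exists u => // x Cx.
  have -> : x = 0 by apply: contrapT => xn; apply: h; exists x.
  exact: Lset0.
have [r [u e0]] : rk1 x0 by rewrite -[x0]subr0; exact: Cc.
have r0 : r <> 0 by move=> r0; apply: x0n; rewrite e0 r0 tn0l.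
have u0 : u <> 0 by move=> u0; apply: x0n; rewrite e0 u0 tn0r.
case: (EM (exists2 x, C x & ~ Jset r x)) => [[x1 Cx1 x1n]|h]; last first.
  right; exists r => // x Cx.
  by apply: contrapT => xn; apply: h; exists x.
left; exists u => // x Cx.
have [s' [u' e1]] : rk1 x1 by rewrite -[x1]subr0; exact: Cc.
have [s e1'] : exists s, x1 = s ** u.
  have := Cc _ _ Cx1 Cx0; rewrite e0 e1 => /(rk1_sub r0 u0) [] [k e].
    by case: x1n; exists (k *: u'); rewrite -tnZ -e.
  by exists (rs s' k); rewrite tnZ -e.
have sr k : s <> rs r k.
  by move=> e; apply: x1n; exists (k *: u); rewrite -tnZ -e.
have s0 : s <> 0 by move=> s0; apply: (sr 0); rewrite rs0.
have [t [w e2]] : rk1 x by rewrite -[x]subr0; exact: Cc.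
have := Cc _ _ Cx Cx0; rewrite e0 e2 => /(rk1_sub r0 u0) [] [k e]; last first.
  by exists (rs t k); rewrite tnZ -e.
have := Cc _ _ Cx Cx1; rewrite e1' e2 => /(rk1_sub s0 u0) [] [l e']; last first.
  by exists (rs t l); rewrite tnZ -e'.
case: (EM (t = 0)) => [->|t0]; first by rewrite tn0l; exact: Lset0.
have [m rm] := rs_common t0 e (esym (rs1 r)).
have [m' sm] := rs_common t0 e' (esym (rs1 s)).
by have [n] := rs_common r0 rm sm => /sr.
Qed.

End DualTensor.

(** * Bijections preserving rank-one differences *)

Section Hua.
Variables (K : unitRingType) (fieldK : GRing.field_axiom K).
Variables (U : lmodType K) (D R : zmodType) (S : dual_tensor U D R).
Variables (K' : unitRingType) (fieldK' : GRing.field_axiom K').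
Variables (U' : lmodType K') (D' R' : zmodType) (S' : dual_tensor U' D' R').

Definition rk1_iso (f : R -> R') : Prop :=
  [/\ bijective f, f 0 = 0 &
      forall x y, rk1 S (y - x) <-> rk1 S' (f y - f x)].

Definition LtoL (f : R -> R') := forall u, u <> 0 ->
  exists2 u', u' <> 0 & forall x, Lset S u x <-> Lset S' u' (f x).
Definition JtoJ (f : R -> R') := forall r, r <> 0 ->
  exists2 r', r' <> 0 & forall x, Jset S r x <-> Jset S' r' (f x).
Definition LtoJ (f : R -> R') := forall u, u <> 0 ->
  exists2 r', r' <> 0 & forall x, Lset S u x <-> Jset S' r' (f x).
Definition JtoL (f : R -> R') := forall r, r <> 0 ->
  exists2 u', u' <> 0 & forall x, Jset S r x <-> Lset S' u' (f x).

Lemma rk1_iso_eq0 f x : rk1_iso f -> f x = 0 -> x = 0.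
Proof. by case=> /bij_inj finj f0 _; rewrite -f0 => /finj. Qed.

(** By [clique_sub] the image of [A] lies in a standard clique. The preimage of the latter is a
    clique containing [A], hence lies in a standard clique itself, and the last two hypotheses,
    which express maximality of [A], give equality. *)
Lemma maxclique_image f (A : R -> Prop) : rk1_iso f -> A 0 ->
    (forall x y, A x -> A y -> rk1 S (y - x)) ->
    (forall u, u <> 0 -> (forall x, A x -> Lset S u x) ->
       forall x, Lset S u x -> A x) ->
    (forall r, r <> 0 -> (forall x, A x -> Jset S r x) ->
       forall x, Jset S r x -> A x) ->
  (exists2 u', u' <> 0 & forall x, A x <-> Lset S' u' (f x)) \/
  (exists2 r', r' <> 0 & forall x, A x <-> Jset S' r' (f x)).
Proof.
move=> [fbij f0 fH] A0 Acl AL AJ.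
have max (B : R' -> Prop) : B 0 -> (forall x y, B x -> B y -> rk1 S' (y - x)) ->
    (forall x, A x -> B (f x)) -> forall x, A x <-> B (f x).
  move=> B0 Bcl AB x; split; first exact: AB.
  have [||[u u0 h]|[r r0 h]] := clique_sub fieldK (S := S) (C := fun x =>
    B (f x)).
  - by rewrite f0.
  - by move=> y z yB zB; apply/fH; apply: Bcl.
  - by move/h; apply: AL => // y /AB/h.
  - by move/h; apply: AJ => // y /AB/h.
have [||[u u0 h]|[r r0 h]] := clique_sub fieldK' (S := S')
    (C := fun y => exists2 x, A x & f x = y).
- by exists 0.
- by move=> _ _ [x Ax <-] [y Ay <-]; apply/fH; exact: Acl.
- left; exists u => //; apply: max; first exact: Lset0.
    by move=> x y; exact: Lset_rk1.
  by move=> x Ax; apply: h; exists x.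
- right; exists r => //; apply: max; first exact: Jset0.
    by move=> x y; exact: Jset_rk1.
  by move=> x Ax; apply: h; exists x.
Qed.

Lemma Lset_image f u : rk1_iso f -> u <> 0 ->
  (exists2 u', u' <> 0 & forall x, Lset S u x <-> Lset S' u' (f x)) \/
  (exists2 r', r' <> 0 & forall x, Lset S u x <-> Jset S' r' (f x)).
Proof.
move=> fi u0; apply: maxclique_image => //.
- exact: Lset0.
- by move=> x y; exact: Lset_rk1.
- move=> v v0 sub x; have [r r0] := exists_neq0_dual S.
  rewrite -(LsetE fieldK (S := S) (u := u) x u0 v0 (tn_neq0 fieldK r0 u0)) //;
    first by exists r.
  by apply: sub; exists r.
- move=> r r0 sub x; have [y [uy []]] := LJ_notsub fieldK S u0 r0.
  exact: sub.
Qed.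

Lemma Jset_image f r : rk1_iso f -> r <> 0 ->
  (exists2 u', u' <> 0 & forall x, Jset S r x <-> Lset S' u' (f x)) \/
  (exists2 r', r' <> 0 & forall x, Jset S r x <-> Jset S' r' (f x)).
Proof.
move=> fi u0; apply: maxclique_image => //.
- exact: Jset0.
- by move=> x y; exact: Jset_rk1.
- move=> v v0 sub x; have [y [uy []]] := JL_notsub fieldK S v0 u0.
  exact: sub.
- move=> v v0 sub x; have [r0 r00] := exists_neq0 S.
  rewrite -(JsetE fieldK (S := S) (p := r) x u0 v0 (tn_neq0 fieldK u0 r00)) //;
    first by exists r0.
  by apply: sub; exists r0.
Qed.

(** Cliques [Lset S u] and [Jset S r] share the nonzero [tn S r u], whereas two cliques of one type
    with a common nonzero element coincide. So their images have opposite types, and the type of a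
    single image decides all others. *)
Lemma rk1_iso_type f : rk1_iso f -> (LtoL f /\ JtoJ f) \/ (LtoJ f /\ JtoL f).
Proof.
move=> fi.
have crossL u r u' u2 : u <> 0 -> r <> 0 -> u' <> 0 -> u2 <> 0 ->
    (forall x, Lset S u x <-> Lset S' u' (f x)) ->
    (forall x, Jset S r x <-> Lset S' u2 (f x)) -> False.
  move=> u0 r0 u'0 u20 h1 h2.
  have [x [ux []]] := LJ_notsub fieldK S u0 r0; apply/h2.
  have y0 := tn_neq0 fieldK (S := S) r0 u0.
  rewrite -(LsetE fieldK' (f x) u'0 u20 (x := f (tn S r u))); first exact/h1.
  - by move/(rk1_iso_eq0 fi).
  - by apply/h1; exists r.
  - by apply/h2; exists u.
have crossJ u r u' u2 : u <> 0 -> r <> 0 -> u' <> 0 -> u2 <> 0 ->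
    (forall x, Lset S u x <-> Jset S' u' (f x)) ->
    (forall x, Jset S r x <-> Jset S' u2 (f x)) -> False.
  move=> u0 r0 u'0 u20 h1 h2.
  have [x [ux []]] := LJ_notsub fieldK S u0 r0; apply/h2.
  have y0 := tn_neq0 fieldK (S := S) r0 u0.
  rewrite -(JsetE fieldK' (f x) u'0 u20 (x := f (tn S r u))); first exact/h1.
  - by move/(rk1_iso_eq0 fi).
  - by apply/h1; exists r.
  - by apply/h2; exists u.
have [u0 u0n] := exists_neq0 S; have [r0 r0n] := exists_neq0_dual S.
case: (Lset_image fi u0n) => [[u' u'0 h]|[u' u'0 h]]; [left|right].
  have JJ : JtoJ f.
    move=> r rn; case: (Jset_image fi rn) => // -[u2 u20 h2].
    by case: (crossL _ _ _ _ u0n rn u'0 u20 h h2).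
  split=> // u un; case: (Lset_image fi un) => // -[r' r'0 h1].
  by have [r2 r20 h2] := JJ _ r0n; case: (crossJ _ _ _ _ un r0n r'0 r20 h1 h2).
have JL : JtoL f.
  move=> r rn; case: (Jset_image fi rn) => // -[u2 u20 h2].
  by case: (crossJ _ _ _ _ u0n rn u'0 u20 h h2).
split=> // u un; case: (Lset_image fi un) => // -[r' r'0 h1].
by have [r2 r20 h2] := JL _ r0n; case: (crossL _ _ _ _ un r0n r'0 r20 h1 h2).
Qed.

(** Translations on both sides bring [a] and [f a] to 0, so that cliques through [a] become cliques
    through 0. *)
Definition recentre (f : R -> R') a x := f (a + x) - f a.

Lemma recentre_iso f a : rk1_iso f -> rk1_iso (recentre f a).
Proof.
move=> [[g gK fK] f0 fH]; split.
- exists (fun y => g (y + f a) - a) => x; rewrite /recentre /=.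
    by rewrite subrK gK addrC addKr.
  by rewrite [a + _]addrC subrK fK addrK.
- by rewrite /recentre addr0 subrr.
- move=> x y; rewrite /recentre opprB addrA subrK -fH opprD addrA.
  by rewrite [a + y]addrC addrK.
Qed.

Definition LJ_iso f := [/\ rk1_iso f, LtoL f & JtoJ f].

(** The types cannot be exchanged here: [Lset S v] contains [tn S s v], hence is invariant under the
    translation, and is still sent to the same [Lset S' v']. *)
Lemma recentre_tn f s v : LJ_iso f -> LJ_iso (recentre f (tn S s v)).
Proof.
move=> [fi fL fJ]; have fa := recentre_iso (tn S s v) fi.
case: (EM (s = 0 \/ v = 0)) => [sv|sv].
  have -> : recentre f (tn S s v) = f.
    apply/funext => x; rewrite /recentre /=.
    have -> : tn S s v = 0 by case: sv => ->; rewrite ?tn0l ?tn0r.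
    by case: fi => _ -> _; rewrite add0r subr0.
  by [].
have v0 : v <> 0 by move=> v0; apply: sv; right.
case: (rk1_iso_type fa) => [[L J]|[LJ _]]; first by split.
have [v' v'0 h] := fL _ v0; have [r' r'0 h2] := LJ _ v0.
have [y [ry []]] := JL_notsub fieldK' S' v'0 r'0.
have [[g gK fK] _ _] := fa.
have := ry; rewrite -[y]fK -h2 /recentre => vy.
have va : Lset S v (tn S s v) by exists s.
rewrite addrC; apply/LsetDl; last by apply/h; apply/LsetDl.
by apply: LsetN; apply/h.
Qed.

(* If s (x) v is not in J_r, then J_r and its translate by s (x) v are disjoint,
   but each element of one has rank-one distance to an element of the other;
   this fails for cosets of two different cliques J_p and J_q. *)
Lemma parallel f s v r r' : LJ_iso f -> r <> 0 -> r' <> 0 ->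
  (forall x, Jset S r x <-> Jset S' r' (f x)) ->
  forall x, Jset S r x <-> Jset S' r' (recentre f (tn S s v) x).
Proof.
move=> fi r0 r'0 h; set a := tn S s v.
have [[[g gK fK] f0 fH] fL fJ] := fi.
case: (EM (Jset S r a)) => [ra x|ra].
  have r'fa : Jset S' r' (f a) by apply/h.
  by rewrite -(JsetDl x ra) h /recentre [f _ - f a]addrC JsetDl //;
    exact: JsetN.
have [fai _ faJ] := recentre_tn s v fi.
have [q q0 hq] := faJ _ r0.
have [[ga gaK faK] _ _] := fai.
suff [k qk] : exists k, q = rscale S' r' k.
  by move=> x; rewrite hq (JsetZ fieldK' _ q0 qk).
apply: contrapT => hn.
have {}hn k : q <> rscale S' r' k by move=> e; apply: hn; exists k.
have rq := rs_notin fieldK' r'0 hn.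
have v0 : v <> 0 by move=> v0; apply: ra; rewrite /a v0 tn0r; exact: Jset0.
have [s' [v' efa]] : rk1 S' (f a).
  by rewrite -[f a]subr0 -f0 -fH subr0; exists s, v.
have fa0 : f a <> 0.
  by rewrite -f0 => /(can_inj gK) a0; apply: ra; rewrite a0; exact: Jset0.
have v'0 : v' <> 0 by move=> v'0; apply: fa0; rewrite efa v'0 tn0r.
(* Otherwise [f a] is the sum of a member of J_r' and one of J_q. Pulled back, this makes a point of
   J_r also a point of a + J_r, so that [a] lies in J_r. *)
have dis k l : s' <> rscale S' r' k + rscale S' q l.
  move=> e; apply: ra.
  have r'x : Jset S r (g (tn S' r' (k *: v'))).
    by apply/h; rewrite fK; exists (k *: v').
  have r'y : Jset S r (ga (tn S' q (- (l *: v')))).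
    by apply/hq; rewrite faK; exists (- (l *: v')).
  have := faK (tn S' q (- (l *: v'))).
  rewrite {1}/recentre => /eqP;
    rewrite subr_eq efa e tnDl !tnZ tnNr addrCA addNr addr0.
  move=> /eqP/(congr1 g); rewrite gK => e2.
  by move: r'x; rewrite -e2 -tnNr addrC (JsetDl _ r'y).
(* The preimage of [tn S' r' w] and its translate by [a] differ by one tensor, but their images
   differ by a map excluded by [rk1_triple]. *)
have [w wv] := exists_indep fieldK' S' v'0.
have rx : Jset S r (g (tn S' r' w)) by apply/h; rewrite fK; exists w.
have [y ey] : Jset S' q (recentre f (tn S s v) (g (tn S' r' w))) by apply/hq.
apply: (rk1_triple fieldK' rq dis v'0 wv (y := y)).
have -> : tn S' r' w - tn S' s' v' - tn S' q y =
    f (g (tn S' r' w)) - f (a + g (tn S' r' w)).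
  by rewrite fK -efa -ey /recentre opprB addrA subrK.
by rewrite -fH opprD addrCA subrr addr0; exists (- s), v; rewrite tnNl.
Qed.

(** Every [a] is a sum of tensors and recentrings compose, so [parallel] applies one tensor at a
    time; the same r' then serves at every base point. *)
Lemma recentre_LJ f a : LJ_iso f -> LJ_iso (recentre f a) /\
  forall r r', r <> 0 -> r' <> 0 ->
    (forall x, Jset S r x <-> Jset S' r' (f x)) ->
    forall x, Jset S r x <-> Jset S' r' (recentre f a x).
Proof.
move=> fi; elim/(tn_ind (d := S)): a => [|a r u [IH1 IH2]].
  have -> : recentre f 0 = f.
    by apply/funext => x; case: fi => -[_ f0 _] _ _;
      rewrite /recentre f0 add0r subr0.
  by [].
have -> : recentre f (a + tn S r u) = recentre (recentre f a) (tn S r u).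
  by apply/funext => x; rewrite /recentre opprB addrA subrK addrA.
split; first exact: recentre_tn.
move=> p p' p0 p'0 h; apply: parallel => //; exact: IH2.
Qed.

(* By parallelism the increments of [f] in the directions r (x) u and s (x) v
   stay in J_r' and J_s', so their mixed second difference lies in both. *)
Lemma LJ_iso_additive f : LJ_iso f -> forall a b, f (a + b) = f a + f b.
Proof.
move=> fi; have [[_ f0 _] fL fJ] := fi.
have step s v r u a : (forall k, s <> rscale S r k) ->
  recentre f (a + tn S s v) (tn S r u) = recentre f a (tn S r u).
  move=> sr; case: (EM (r = 0)) => [->|r0].
    by rewrite /recentre tn0l !addr0 !subrr.
  have s0 : s <> 0 by move=> s0; apply: (sr 0); rewrite rs0.
  have [r' r'0 hr] := fJ _ r0; have [s' s'0 hs] := fJ _ s0.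
  have hra b := (recentre_LJ b fi).2 _ _ r0 r'0 hr.
  have hsa b := (recentre_LJ b fi).2 _ _ s0 s'0 hs.
  set d1 := LHS; set d2 := RHS.
  have dr : Jset S' r' (d1 - d2).
    by apply: JsetD; last apply: JsetN; apply/hra; exists u.
  have ds : Jset S' s' (d1 - d2).
    have -> : d1 - d2 = recentre f (a + tn S r u) (tn S s v) - recentre f a (tn
      S s v).
      rewrite /d1 /d2 /recentre [a + _ + tn S s v]addrAC !opprB -!addrA.
      by congr (_ + _); rewrite addrC -addrA addrCA.
    by apply: JsetD; last apply: JsetN; apply/hsa; exists v.
  apply/eqP; rewrite -subr_eq0; apply/eqP; apply: contrapT => d0.
  (* A nonzero common element makes s' a multiple of r', so that J_r and J_s have the same image;
     this contradicts the independence of [r] and [s]. *)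
  have [k sk] := JsetI fieldK' r'0 s'0 d0 dr ds.
  have [u0 u0n] := exists_neq0 S.
  have sJ : Jset S s (tn S s u0) by exists u0.
  have [w e] : Jset S r (tn S s u0) by apply/hr;
    apply/(JsetZ fieldK' _ s'0 sk); apply/hs.
  have [[m rm] _] := tn_prop fieldK s0 u0n e.
  exact: (rs_notin fieldK r0 sr rm).
have inv r u a : recentre f a (tn S r u) = f (tn S r u).
  case: (EM (r = 0)) => [->|r0].
    by rewrite /recentre tn0l f0 addr0 subrr.
  elim/(tn_ind (d := S)): a => [|a s v IH].
    by rewrite /recentre f0 add0r subr0.
  case: (EM (forall k, s <> rscale S r k)) => [|h]; first by move/step->.
  have [k sk] : exists k, s = rscale S r k.
    by apply: contrapT => h2; apply: h => k e; apply: h2; exists k.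
  have [t tr] := exists_indep_dual fieldK S r0.
  (* When [s] is a multiple of [r], both s + t and - t are independent of [r], so [step] applies
     twice. *)
  have -> : a + tn S s v = a + tn S (s + t) v + tn S (- t) v.
    by rewrite -addrA -tnDl addrK.
  rewrite step; last first.
    move=> l e; apply: (tr (- l)); rewrite -[t]opprK e.
    by apply: (pr_extr (S := S)) => z; rewrite !prE mulrN.
  rewrite step // => l; rewrite sk => e; apply: (tr (l - k)).
  have -> : t = rscale S r l - rscale S r k by rewrite -e addrC addKr.
  by apply: (pr_extr (S := S)) => z; rewrite !prE mulrBr.
move=> a b; elim/(tn_ind (d := S)): b => [|b r u IH].
  by rewrite f0 !addr0.
have eqD x : f (x + tn S r u) = f x + f (tn S r u).
  by rewrite -(inv r u x) /recentre [RHS]addrC subrK.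
by rewrite addrA !eqD IH addrA.
Qed.

(** Since [h] is defined with [r0] fixed and [g] with [u0] fixed, f (r (x) u) agrees with g r (x) h
    u at first only up to a scalar depending on r and u. By additivity the scalar 1 at [u0]
    propagates to all u. *)
Lemma LJ_iso_tensor f : LJ_iso f -> exists (g : D -> D') (h : U -> U'),
  [/\ forall r u, f (tn S r u) = tn S' (g r) (h u),
      forall u v, h (u + v) = h u + h v,
      forall u, u <> 0 -> h u <> 0 &
      exists sigma : K -> K', forall k u, h (k *: u) = sigma k *: h u].
Proof.
move=> fi; have [fi0 fL fJ] := fi; have fD := LJ_iso_additive fi.
have [r0 r0n] := exists_neq0_dual S; have [u0 u0n] := exists_neq0 S.
have [r0' r0'n hr0] := fJ _ r0n.
have fn0 r u : r <> 0 -> u <> 0 -> f (tn S r u) <> 0.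
  by move=> rn un /(rk1_iso_eq0 fi0); exact: (tn_neq0 fieldK rn un).
have /choice[h hP] u : exists v, f (tn S r0 u) = tn S' r0' v.
  by apply/hr0; exists u.
have hn0 u : u <> 0 -> h u <> 0.
  by move=> un hu; apply: (fn0 _ _ r0n un); rewrite hP hu tn0r.
have hD u v : h (u + v) = h u + h v.
  by apply: (tn_injr (S := S') fieldK' r0'n); rewrite tnDr -!hP tnDr fD.
have hL u x : u <> 0 -> Lset S u x <-> Lset S' (h u) (f x).
  move=> un; have [u' u'n hu'] := fL _ un; rewrite hu'.
  apply: (LsetE fieldK' (f x) u'n (hn0 _ un) (fn0 _ _ r0n un)).
    by apply/hu'; exists r0.
  by rewrite hP; exists r0'.
have /choice[g gP] r : exists s, f (tn S r u0) = tn S' s (h u0).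
  by apply/hL => //; exists r.
have gn0 r : r <> 0 -> g r <> 0.
  by move=> rn gr; apply: (fn0 _ _ rn u0n); rewrite gP gr tn0l.
have gJ r x : r <> 0 -> Jset S r x <-> Jset S' (g r) (f x).
  move=> rn; have [r' r'n hr'] := fJ _ rn; rewrite hr'.
  apply: (JsetE fieldK' (f x) r'n (gn0 _ rn) (fn0 _ _ rn u0n)).
    by apply/hr'; exists u0.
  by rewrite gP; exists (h u0).
have hindep u v : u <> 0 -> (forall k, v <> k *: u) ->
  forall k, h v <> k *: h u.
  move=> un vu k e.
  have vn : v <> 0 by move=> vn; apply: (vu 0); rewrite scale0r.
  have [s] : Lset S u (tn S r0 v).
    by apply/hL => //; exists (rscale S' r0' k); rewrite hP tnZ -e.
  move=> /(tn_prop fieldK r0n vn)[_ [l /esym ul]].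
  exact: (scale_notin fieldK un vu) (esym ul).
have prop r u : r <> 0 -> u <> 0 ->
  exists k, f (tn S r u) = tn S' (g r) (k *: h u).
  move=> rn un; have [v e1] : Jset S' (g r) (f (tn S r u)) by apply/gJ => //;
    exists u.
  have [s] : Lset S' (h u) (f (tn S r u)) by apply/hL => //; exists r.
  rewrite e1 => e2; case: (EM (v = 0)) => [->|vn]; first by exists 0;
    rewrite scale0r.
  have [_ [k huv]] := tn_prop fieldK' (gn0 _ rn) vn e2.
  have [m vm] := scale_common fieldK' (hn0 _ un) huv (esym (scale1r v)).
  by exists m; rewrite -vm.
(* Expanding f (r (x) (u + v)) in two ways gives a relation between the independent vectors [h u]
   and [h v], whose coefficients must vanish. *)
have step r u v : r <> 0 -> u <> 0 -> (forall k, v <> k *: u) ->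
    f (tn S r u) = tn S' (g r) (h u) -> f (tn S r v) = tn S' (g r) (h v).
  move=> rn un vu ru.
  have vn : v <> 0 by move=> vn; apply: (vu 0); rewrite scale0r.
  have uvn : u + v <> 0.
    by move=> /eqP; rewrite addrC addr_eq0 => /eqP e; apply: (vu (-1));
      rewrite scaleN1r.
  have [k ek] := prop _ _ rn vn; have [l el] := prop _ _ rn uvn.
  have := el; rewrite tnDr fD ru ek -tnDr => /(tn_injr fieldK' (gn0 _ rn)).
  rewrite hD scalerDr => e.
  have e1 : (k - l) *: h v = (l - 1) *: h u.
    rewrite !scalerBl scale1r; apply/eqP; rewrite subr_eq addrAC -e.
    by rewrite addrAC subrr add0r.
  have kl : k = l.
    apply: contrapT => kl; have kl0 : k - l <> 0.
      by move/eqP; rewrite subr_eq0 => /eqP.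
    have := scale_cancel fieldK' kl0 e1; rewrite scalerA.
    exact: hindep.
  move: e1; rewrite kl subrr scale0r => e1.
  have [l1|l1] := EM (l - 1 = 0).
    by move/eqP: l1; rewrite subr_eq0 => /eqP ->; rewrite scale1r.
  by case: (hn0 _ un); rewrite (scale_cancel fieldK' l1 (esym e1)) scaler0.
have fE r u : f (tn S r u) = tn S' (g r) (h u).
  case: (EM (u = 0)) => [->|un].
    have -> : h 0 = 0.
      by have := hD 0 0; rewrite addr0 -{1}[h 0]addr0 => /addrI.
    by rewrite !tn0r; case: fi0.
  case: (EM (r = 0)) => [r00|rn].
    have g00 : g 0 = 0.
      apply: (tn_injl (S := S') fieldK' (hn0 _ u0n)); rewrite -gP !tn0l;
        by case: fi0.
    by rewrite r00 g00 !tn0l; case: fi0.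
  case: (EM (exists k, u = k *: u0)) => [[k uk]|nk]; last first.
    by apply: (step _ _ _ rn u0n) => // k e; apply: nk; exists k.
  (* Multiples of [u0] are reached by a detour through some [v] off its line. *)
  have [v vu0] := exists_indep fieldK S u0n.
  have vn : v <> 0 by move=> vn; apply: (vu0 0); rewrite scale0r.
  apply: (step _ v) => //; last exact: (step _ _ _ rn u0n).
  move=> l e; have [m] := scale_common fieldK un e (esym (scale1r v)).
  by rewrite uk scalerA; exact: vu0.
have gn r : r <> 0 -> g r <> 0 by exact: gn0.
exists g, h; split=> //.
have /choice[sigma sP] k : exists l, h (k *: u0) = l *: h u0.
  have [->|kn] := EM (k = 0).
    exists 0; rewrite !scale0r.
    by have := hD 0 0; rewrite addr0 -{1}[h 0]addr0 => /addrI.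
  have ku0 : k *: u0 <> 0.
    by move=> /(scale_cancel fieldK kn); rewrite scaler0.
  have := fE (rscale S r0 k) u0; rewrite tnZ fE => e.
  have [_ [l hl]] := tn_prop fieldK' (gn0 _ r0n) (hn0 _ ku0) e.
  exact: (scale_common fieldK' (hn0 _ u0n) hl (esym (scale1r _))).
exists sigma => k u.
(* Scalars can be moved across a tensor, so [g] and [h] share one [sigma]; this frees it from the
   choice of [u0]. *)
have gk r : g (rscale S r k) = rscale S' (g r) (sigma k).
  apply: (tn_injl (S := S') fieldK' (hn0 _ u0n)).
  by rewrite -fE tnZ fE sP tnZ.
by apply: (tn_injr (S := S') fieldK' (gn0 _ r0n));
  rewrite -fE -(tnZ S) fE gk tnZ.
Qed.

(** The second hypothesis detects only the value 1. Adding [u1], where [s] is 1, detects the value 0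
    as well, and splitting [u] along [u1] and the kernel of [s] reaches every value by semilinearity
    of [h]. The conclusion concerns a product of two tensors, compare [tens_mul]. *)
Lemma LJ_iso_mul f : LJ_iso f ->
    (forall r u s v, f (tn S r u) = tn S' s v ->
      pr S u r = 1 <-> pr S' v s = 1) ->
  exists (g : D -> D') (h : U -> U'),
    (forall r u, f (tn S r u) = tn S' (g r) (h u)) /\
    forall r u s v,
      f (tn S r (pr S u s *: v)) = tn S' (g r) (pr S' (h u) (g s) *: h v).
Proof.
move=> fi f1; have [g [h [fE hD hn0 [sigma hZ]]]] := LJ_iso_tensor fi.
exists g, h; split=> // r u s v.
suff -> : pr S' (h u) (g s) = sigma (pr S u s) by rewrite fE hZ.
have eq1 w t : pr S w t = 1 <-> pr S' (h w) (g t) = 1 by apply: f1.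
have [w0|wn] := EM (s = 0).
  have [u1 u1n] := exists_neq0 S.
  have s0 : sigma 0 = 0.
    apply: contrapT => s0; have := hZ 0 u1; rewrite scale0r => h0.
    have h00 : h 0 = 0 by have := hD 0 0;
      rewrite addr0 -{1}[h 0]addr0 => /addrI.
    move: h0; rewrite h00 => /esym/(scale_cancel fieldK' s0).
    by rewrite scaler0; exact: hn0.
  have g0 : g 0 = 0.
    have := fE 0 u1; rewrite tn0l.
    have -> : f 0 = 0 by case: fi => -[].
    by move=> /esym /(tn_eq0 fieldK') [] // /hn0.
  by rewrite w0 g0 !pr0r s0.
have [u1 u1s] := sep1 fieldK S wn.
have zero w : pr S w s = 0 -> pr S' (h w) (g s) = 0.
  move=> ws; have := (eq1 (w + u1) s).1.
  rewrite prDl ws add0r u1s hD prDl => /(_ erefl).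
  by rewrite ((eq1 u1 s).1 u1s) => /eqP;
    rewrite -[X in _ == X]add0r => /eqP/addIr.
have -> : u = pr S u s *: u1 + (u - pr S u s *: u1) by rewrite addrC subrK.
rewrite hD hZ !(prDl, prZl) u1s ((eq1 u1 s).1 u1s) !mulr1.
rewrite zero ?addr0; last by rewrite !prE u1s mulr1 subrr.
by rewrite !prE u1s mulr1 subrr addr0.
Qed.
End Hua.

(** * Linear algebra over skew fields *)

Section RowDependence.
Variables (K : unitRingType) (fieldK : GRing.field_axiom K).

(** Gaussian elimination on the first column, with multipliers on the left. A relation [c] among the
    reduced rows [B] extends to [A]: the coefficient of the pivot row [i0] collects what was
    subtracted. *)
Lemma row_dependence n (A : 'M[K]_(n.+1, n)) :
  exists2 c : 'rV_n.+1, c <> 0 & c *m A = 0.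
Proof.
elim: n A => [|n IH] A.
  exists (const_mx 1); last by apply/rowP => -[].
  by move=> /rowP/(_ 0)/eqP; rewrite !mxE oner_eq0.
have [i0 [a aP]] : exists i0 : 'I_n.+2, exists a : 'I_n.+2 -> K,
    forall i, A i 0 = a i * A i0 0.
  case: (EM (exists i, A i 0 <> 0)) => [[i0 ai0]|h].
    by exists i0, (fun i => A i 0 * (A i0 0)^-1) => i;
      rewrite -mulrA fmulVr ?mulr1.
  (* In a zero column any row may act as pivot, with zero multipliers. *)
  exists 0, (fun=> 0) => i; rewrite mul0r; apply: contrapT => hi.
  by apply: h; exists i.
pose B : 'M[K]_(n.+1, n) := \matrix_(i, j)
  (A (lift i0 i) (lift 0 j) - a (lift i0 i) * A i0 (lift 0 j)).
have [c c0 cB] := IH B.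
pose d : 'rV[K]_n.+2 := \row_k
  (if unlift i0 k is Some i then c 0 i else - \sum_i c 0 i * a (lift i0 i)).
have dl i : d 0 (lift i0 i) = c 0 i by rewrite mxE liftK.
exists d; first by move=> d0; apply: c0; apply/rowP => i; rewrite -dl d0 !mxE.
apply/rowP => j; rewrite !mxE (bigD1_ord i0) //=.
have -> : d 0 i0 = - \sum_i c 0 i * a (lift i0 i) by rewrite mxE unlift_none.
under eq_bigr do rewrite dl.
rewrite mulNr mulr_suml addrC -sumrB.
under eq_bigr do rewrite -mulrA -mulrBr.
case: (unliftP 0 j) => [j'|] ->.
  have := congr1 (fun M : 'rV_n => M 0 j') cB; rewrite !mxE => e;
    apply: etrans e.
  by apply: eq_bigr => i _; rewrite !mxE.
by apply: big1 => i _; rewrite -aP subrr mulr0.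
Qed.
End RowDependence.

Section Endo.
Variables (K : nzRingType) (U : vectType K).
Implicit Types (x y : endo U) (u v z : U).

Definition ap x z : U := (x : 'End(U)) z.

Lemma apM x y z : ap (x * y) z = ap y (ap x z).
Proof. exact: comp_lfunE. Qed.
Lemma ap1 z : ap 1 z = z.
Proof. exact: id_lfunE. Qed.
Lemma ap0 z : ap 0 z = 0.
Proof. exact: zero_lfunE. Qed.
Lemma apD x y z : ap (x + y) z = ap x z + ap y z.
Proof. exact: (add_lfunE (x : 'End(U)) y z). Qed.
Lemma apN x z : ap (- x) z = - ap x z.
Proof. exact: (opp_lfunE (x : 'End(U)) z). Qed.
Lemma apDr x u v : ap x (u + v) = ap x u + ap x v.
Proof. exact: linearD. Qed.
Lemma apNr x u : ap x (- u) = - ap x u.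
Proof. exact: linearN. Qed.
Lemma ap0r x : ap x 0 = 0.
Proof. exact: linear0. Qed.
Lemma apZ x k u : ap x (k *: u) = k *: ap x u.
Proof. exact: linearZ. Qed.
Lemma endo_ext x y : (forall z, ap x z = ap y z) -> x = y.
Proof. by move=> xy; apply/(@lfunP K U U x y). Qed.

Lemma endo_of_linear (f : U -> U) : linear f ->
  exists x, forall z, ap x z = f z.
Proof.
move=> lin; pose g : {linear U ->
  U} := HB.pack f (GRing.isLinear.Build K U U _ _ lin).
by exists (linfun g) => z; exact: (lfunE g).
Qed.

Definition apE := (apM, ap1, ap0, apD, apN, apDr, apNr, ap0r, apZ).

Definition form_of (f : U -> K) : linear (f : U -> K^o) ->
  {r : dual U | forall u, pairing u r = f u}.
Proof.
move=> lin; pose g : {linear U -> K^o} :=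
  HB.pack (f : U -> K^o) (GRing.isLinear.Build K U K^o _ _ lin).
by exists (linfun g) => u; exact: (lfunE g).
Qed.

Lemma pairing_scale k f u : pairing u (k *: f) = pairing u f * k.
Proof. exact: dual_scaleE. Qed.

Lemma pairingDl u v (r : dual U) : pairing (u + v) r = pairing u r + pairing v
  r.
Proof. by rewrite /pairing linearD. Qed.
Lemma pairingZl k u (r : dual U) : pairing (k *: u) r = k * pairing u r.
Proof. by rewrite /pairing linearZ. Qed.

Fact tens_linear (r : dual U) u : linear (fun z => pairing z r *: u).
Proof. by move=> k v w; rewrite pairingDl pairingZl scalerDl scalerA. Qed.

Definition tens (r : dual U) u : endo U := sval (cid (endo_of_linear
  (tens_linear r u))).
Lemma tensE r u z : ap (tens r u) z = pairing z r *: u.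
Proof. exact: (svalP (cid (endo_of_linear (tens_linear r u)))). Qed.

End Endo.

Section FiniteDim.
Variables (K : unitRingType) (fieldK : GRing.field_axiom K) (U : vectType K).
Implicit Types (x : endo U) (u v y z : U).
Import VectorInternalTheory.

(** The vector [y] and the rows of the matrix of [x] are too many to be independent; injectivity
    makes the coefficient [k] of [y] nonzero, so the relation can be solved for [y]. *)
Lemma inj_surj x : (forall z, ap x z = 0 -> z = 0) ->
  forall y, exists z, ap x z = y.
Proof.
move=> xinj y; set A := f2mx (x : 'End(U)).
have apA z : ap x z = r2v (v2r z *m A) by rewrite /ap unlock.
have [c c0] := row_dependence fieldK
  (col_mx (v2r y) A : 'M_((dim U).+1, dim U)).
rewrite -[c](@hsubmxK K 1 1 (dim U)) => e0.
have e : lsubmx (c : 'rV_(1 + dim U)) *m v2r y + rsubmx (c : 'rV_(1 + dim U))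
  *m A = 0.
  by rewrite -mul_row_col.
move: e; rewrite [lsubmx _]mx11_scalar mul_scalar_mx.
set k := lsubmx _ _ _; set d := rsubmx _ => e.
case: (EM (k = 0)) => [k0|k0].
  case: c0; rewrite -[c](@hsubmxK K 1 1 (dim U)) -/d.
  have d0 : r2v d = 0.
    apply: xinj; rewrite apA r2vK.
    by move: e; rewrite k0 scale0r add0r => ->; rewrite linear0.
  have -> : d = 0 by rewrite -[d]r2vK d0 linear0.
  by rewrite [lsubmx _]mx11_scalar -/k k0 raddf0 row_mx0.
exists (- (k^-1 *: r2v d)); rewrite !apE apA r2vK.
have -> : d *m A = - (k *: v2r y) by apply/eqP; rewrite -addr_eq0 addrC e.
have rz : r2v (k *: v2r y) = k *: y by rewrite linearZ /= v2rK.
by rewrite (raddfN (@r2v K U)) /= rz scalerN opprK scalerA fmulVr // scale1r.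
Qed.

Definition cvec (i : 'I_(dim U)) : U := r2v (delta_mx 0 i).

Lemma cvec_neq0 i : cvec i <> 0.
Proof.
move=> /(congr1 v2r); rewrite r2vK linear0 => /rowP/(_ i)/eqP.
by rewrite !mxE !eqxx oner_eq0.
Qed.

Lemma vec_sum z : z = \sum_i v2r z 0 i *: cvec i.
Proof.
rewrite -[LHS]v2rK [v2r z in LHS]row_sum_delta raddf_sum /=.
by apply: eq_bigr => i _; rewrite linearZ.
Qed.

Lemma endo_on_basis (F : 'I_(dim U) -> U) :
  exists x, forall z, ap x z = \sum_i v2r z 0 i *: F i.
Proof.
apply: endo_of_linear => k v w; rewrite scaler_sumr -big_split /=.
apply: eq_bigr => i _.
by rewrite linearP !mxE scalerDl scalerA.
Qed.

(** A linear section [t] of [x] is injective, hence surjective by [inj_surj]; thus every vector is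
    some [ap t w], and [x] sends it back to [w]. *)
Lemma surj_inj x : (forall y, exists z, ap x z = y) ->
  forall z, ap x z = 0 -> z = 0.
Proof.
move=> /choice[s sP]; have [t tP] := endo_on_basis (fun i => s (cvec i)).
have tK z : ap x (ap t z) = z.
  rewrite tP [RHS]vec_sum /ap raddf_sum /=; apply: eq_bigr => i _.
  by rewrite linearZ -[in RHS](sP (cvec i)).
have tinj z : ap t z = 0 -> z = 0 by move=> tz; rewrite -(tK z) tz apE.
by move=> z xz; have [w wz] := inj_surj tinj z; rewrite -wz tK in xz;
  rewrite -wz xz apE.
Qed.

Lemma inj_unit x : (forall z, ap x z = 0 -> z = 0) -> unit_elt x.
Proof.
move=> xinj; have /choice[g gP] := inj_surj xinj.
have inj u v : ap x u = ap x v -> u = v.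
  move=> uv; apply/eqP; rewrite -subr_eq0; apply/eqP/xinj.
  by rewrite !apE uv subrr.
have [|y yP] := @endo_of_linear K U g.
  by move=> k u v; apply: inj; rewrite !apE !gP.
exists y; split; apply: endo_ext => z; rewrite !apE !yP ?gP //.
by apply: inj; rewrite gP.
Qed.

Lemma unit_inj x z : unit_elt x -> ap x z = 0 -> z = 0.
Proof. by move=> [y [xy _]] xz; rewrite -[z]ap1 -xy apE xz apE. Qed.

Fact coord_linear i : linear (fun u : U => v2r u 0 i : K^o).
Proof. by move=> k u v; rewrite linearP !mxE. Qed.
Definition coordf i : dual U := sval (form_of (coord_linear i)).
Lemma coordfE i u : pairing u (coordf i) = v2r u 0 i.
Proof. exact: (svalP (form_of (coord_linear i))). Qed.

Lemma exists_form u : u <> 0 -> exists r : dual U, pairing u r = 1.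
Proof.
move=> u0; have [i ui] : exists i, v2r u 0 i <> 0.
  apply: contrapT => h; apply: u0; apply: v2r_inj; rewrite linear0.
  apply/rowP => i; rewrite mxE; apply: contrapT => hi; apply: h.
  by exists i.
exists (((v2r u 0 i)^-1 : K^c) *: coordf i).
by rewrite pairing_scale coordfE fmulrV.
Qed.

Lemma endo_ind (P : endo U -> Prop) : P 0 ->
  (forall a r u, P a -> P (a + tens r u)) -> forall a, P a.
Proof.
move=> P0 PS a.
have -> : a = 0 + \sum_i tens (coordf i) (ap a (cvec i)).
  apply: endo_ext => z; rewrite add0r {1}[z]vec_sum.
  transitivity (\sum_i v2r z 0 i *: ap a (cvec i)).
    by rewrite /ap raddf_sum; apply: eq_bigr => i _; rewrite /= linearZ.
  elim/big_rec2: _ => [|i x y _ ->]; first by rewrite apE.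
  by rewrite !apE tensE coordfE.
suff gen (l : seq 'I_(dim U)) b : P b ->
    P (b + \sum_(i <- l) tens (coordf i) (ap a (cvec i))) by exact: gen.
elim: l b => [|i l IH] b Pb; first by rewrite big_nil addr0.
by rewrite big_cons addrA; apply: IH; exact: PS.
Qed.

Lemma dim1_scale v t : dim U = 1%N -> v <> 0 -> exists k, t = k *: v.
Proof.
move=> dimU v0.
have one (i j : 'I_(dim U)) : i = j.
  by case: i j => [i hi] [j hj]; apply: val_inj => /=; move: hi hj;
    rewrite dimU; case: i; case: j.
have [i vi] : exists i, v2r v 0 i <> 0.
  apply: contrapT => h; apply: v0; apply: v2r_inj; rewrite linear0.
  apply/rowP => i; rewrite mxE; apply: contrapT => hi; apply: h.
  by exists i.
exists (v2r t 0 i / v2r v 0 i); apply: v2r_inj; apply/rowP => j.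
by rewrite linearZ mxE (one j i) -mulrA fmulVr // mulr1.
Qed.

(* [x] is corrected by a tensor whenever [a - b * x] has a kernel vector in the
   span of the first k+1 coordinate vectors. *)
Lemma stable_range (a b : endo U) :
  (forall z, ap a z = 0 -> ap b z = 0 -> z = 0) ->
    exists x, unit_elt (a - b * x).
Proof.
move=> abinj.
suff /(_ (dim U)) [x xP] : forall k, exists x, forall z,
    (forall i : 'I_(dim U), (k <= i)%N -> v2r z 0 i = 0) ->
    ap (a - b * x) z = 0 -> z = 0.
  exists x; apply: inj_unit => z; apply: xP => i.
  by rewrite leqNgt ltn_ord.
elim=> [|k [x IH]].
  exists 0 => z zi _; apply: v2r_inj; rewrite linear0; apply/rowP => i.
  by rewrite zi // mxE.
case: (EM (exists z, [/\ (forall i : 'I_(dim U), (k < i)%N -> v2r z 0 i = 0),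
   ap (a - b * x) z = 0 & z <> 0])) => [[z [zk xz z0]]|h]; last first.
  exists x => z zk xz; apply: contrapT => z0; apply: h.
  by exists z; split.
have bz : ap b z <> 0.
  move=> bz; apply: z0; apply: abinj => //.
  by move: xz; rewrite !apE bz apE subr0.
have kn : (k < dim U)%N.
  rewrite ltnNge; apply/negP => nk; apply: z0; apply: IH => // i ki.
  by have := leq_trans nk ki; rewrite leqNgt ltn_ord.
pose ik := Ordinal kn.
have zk0 : v2r z 0 ik <> 0.
  move=> zk0; apply: z0; apply: IH => // i;
    rewrite leq_eqVlt => /orP[/eqP ki|]; last exact: zk.
  by rewrite -zk0; congr (v2r z 0 _); apply: val_inj.
pose W (t : U) := forall i : 'I_(dim U), (k < i)%N -> v2r t 0 i = 0.
have WB t u c : W t -> W u -> W (t - c *: u).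
  by move=> tW uW i ki; rewrite linearB linearZ !mxE tW // uW // mulr0 subr0.
have red t : W t -> ap (a - b * x) t = 0 -> exists c, t = c *: z.
  move=> tW xt; exists (v2r t 0 ik / v2r z 0 ik); apply/eqP; rewrite -subr_eq0;
    apply/eqP.
  apply: IH; last by rewrite apDr apNr apZ xt xz scaler0 subr0.
  move=> i; rewrite leq_eqVlt => /orP[/eqP ki|]; last exact: WB.
  have -> : i = ik by apply: val_inj.
  by rewrite linearB linearZ !mxE -mulrA fmulVr // mulr1 subrr.
have [p pP] := endo_on_basis (fun i => if (i < k)%N then cvec i else 0).
have pid t : (forall i : 'I_(dim U), (k <= i)%N -> v2r t 0 i = 0) -> ap p t = t.
  move=> tk; rewrite pP [RHS]vec_sum; apply: eq_bigr => i _.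
  by case: ltnP => // /tk ->; rewrite !scale0r.
(* Because of [z], the image of [W] is already that of the span of the first k coordinate vectors.
   Were it everything, [p * (a - b * x)] would be onto, hence injective, although [p] kills
   [cvec ik]. *)
have [y yP] : exists y, forall t, W t -> ap (a - b * x) t <> y.
  apply: contrapT => h.
  have surj y : exists t, ap (p * (a - b * x)) t = y.
    apply: contrapT => hy; apply: h; exists y => t tW e; apply: hy.
    pose t' := t - (v2r t 0 ik / v2r z 0 ik) *: z.
    exists t'; rewrite apM pid; last first.
      move=> i; rewrite leq_eqVlt => /orP[/eqP ki|]; last exact: WB.
      have -> : i = ik by apply: val_inj.
      by rewrite linearB linearZ !mxE -mulrA fmulVr // mulr1 subrr.
    by rewrite apDr apNr apZ xz scaler0 subr0.
  have := surj_inj surj (z := cvec ik).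
  rewrite apM pP big1 ?ap0r => [/(_ erefl)/cvec_neq0 //|i _].
  rewrite r2vK mxE eqxx /=; case: eqP => [->|]; last by rewrite scale0r.
  by rewrite ltnn scaler0.
(* As [r] is 1 at [ap b z], the corrected map sends [z] to [y], which lies outside the image of [W];
   this destroys the only kernel line in [W] and creates no new one. *)
have [r rbz] := exists_form bz.
exists (x - tens r y) => t tW.
have -> : ap (a - b * (x - tens r y)) t = ap (a - b * x) t + pairing (ap b t) r
  *: y.
  by rewrite !apE tensE opprD opprK addrA.
move=> e; have rt : pairing (ap b t) r = 0.
  apply: contrapT => c0; apply: (yP (- ((pairing (ap b t) r)^-1 *: t))).
    move=> i ki; rewrite raddfN /= linearZ !mxE tW //.
    by rewrite mulr0 oppr0.
  rewrite apNr apZ; move/eqP: e; rewrite addr_eq0 => /eqP ->.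
  by rewrite scalerN opprK scalerA fmulVr // scale1r.
move: e; rewrite rt scale0r addr0 => /(red _ tW)[c tc].
by move: rt; rewrite tc apZ pairingZl rbz mulr1 => ->; rewrite scale0r.
Qed.

Lemma tens_mul r u s v : tens r u * tens s v = tens r (pairing u s *: v).
Proof. by apply: endo_ext => z; rewrite !apE !tensE pairingZl scalerA. Qed.

Lemma mul_tens r u x : tens r u * x = tens r (ap x u).
Proof. by apply: endo_ext => z; rewrite !apE !tensE apZ. Qed.

Lemma tens_mull r u x : x * tens r u = tens (transpose x r) u.
Proof. by apply: endo_ext => z; rewrite !apE !tensE transposeE. Qed.

Section DimGe2.
Hypothesis dimU : (1 < dim U)%N.

Definition endo_tensor : @dual_tensor K U (dual U) (endo U).
Proof.
refine (@DualTensor K U (dual U) (endo U) (fun r k => (k : K^c) *: r)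
  (fun u r => pairing u r) (fun r u => tens r u) (fun x z => ap x z)
  _ _ _ _ _ _ _ _ _ _ _).
- exact: pairingDl.
- by move=> u r s; exact (@dual_addE K U r s u).
- exact: pairingZl.
- by move=> u r k; exact: pairing_scale.
- move=> u h; apply: contrapT => /exists_form[r]; rewrite h => /eqP.
  by rewrite eq_sym oner_eq0.
- move=> r h; apply: dual_eq => u; rewrite h; symmetry.
  by rewrite /pairing; exact: (@zero_lfunE K U K^o u).
- exact: apD.
- exact: endo_ext.
- exact: tensE.
- exact: endo_ind.
- exists (cvec (Ordinal (ltnW dimU))), (cvec (Ordinal dimU)); split.
    exact: cvec_neq0.
  move=> k /(congr1 v2r);
    rewrite linearZ /= !r2vK => /rowP/(_ (Ordinal dimU))/eqP.
  by rewrite !mxE !eqxx /= mulr0 oner_eq0.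
Defined.

Definition endo_cotensor : @dual_tensor K^c (dual U) U (endo U).
Proof.
refine (@DualTensor K^c (dual U) U (endo U) (fun u k => (k : K) *: u)
  (fun r u => pairing u r) (fun u r => tens r u) (fun x r => transpose x r)
  _ _ _ _ _ _ _ _ _ _ _).
- by move=> r s u; exact (@dual_addE K U r s u).
- by move=> r u v; exact (@pairingDl K U u v r).
- by move=> k r u; exact (@pairing_scale K U k r u).
- by move=> r u k; exact (@pairingZl K U k u r).
- exact: (pr_eq0r (d := endo_tensor)).
- exact: (pr_eq0l (d := endo_tensor)).
- by move=> x y r; apply: dual_eq => u;
  rewrite dual_addE -!transposeE -pairingDl -[in RHS]apD.
- move=> x y h; apply: endo_ext => z;
  apply: (pr_extl (S := endo_tensor)) => r /=.
  by rewrite !transposeE h.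
- move=> u r s; apply: dual_eq => z.
  by rewrite pairing_scale -transposeE [X in pairing X _]tensE pairingZl.
- by move=> P P0 PS a; apply: endo_ind => // b r u; exact: PS.
- have [r r0] := exists_neq0_dual endo_tensor.
  have [s sr] := exists_indep_dual fieldK endo_tensor r0.
  by exists r, s.
Defined.

End DimGe2.
End FiniteDim.

(** * Adjacency in the projective line of an endomorphism ring *)

Section EndoLine.
Variables (K : unitRingType) (fieldK : GRing.field_axiom K) (U : vectType K).
Implicit Types (a b x y : endo U) (u v w z : U) (r s : dual U).
Implicit Types (p q : proj_line (endo U)) (P Q : 'rV[endo U]_2).

(** A kernel vector z equals [pairing z r *: u]; pairing with [r] shows that a nonzero one exists
    only if [pairing u r] is 1. *)
Lemma unit_tens r u : unit_elt (1 - tens r u) <-> pairing u r <> 1.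
Proof.
split=> [h ur|ur].
  have u0 : u = 0 by apply: (unit_inj h); rewrite !apE tensE ur scale1r subrr.
  by move: ur; rewrite u0 /pairing linear0 => /eqP; rewrite eq_sym oner_eq0.
apply: (inj_unit fieldK) => z; rewrite !apE tensE => /eqP;
  rewrite subr_eq0 => /eqP zu.
suff h : pairing z r = 0 by rewrite zu h scale0r.
apply: contrapT => zr; apply: ur.
have : pairing z r = pairing z r * pairing u r by rewrite {1}zu pairingZl.
move=> /(congr1 (fun k => (pairing z r)^-1 * k)).
by rewrite mulrA (fmulVr fieldK zr) mul1r.
Qed.

Lemma tens_eq0 r u : tens r u = 0 -> r = 0 \/ u = 0.
Proof.
move=> ru; case: (EM (u = 0)) => [|u0]; [by right|left].
apply: dual_eq => z; have [t tu] := exists_form fieldK u0.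
have := congr1 (fun x => pairing (ap x z) t) ru.
rewrite /= tensE pairingZl tu mulr1 => ->; rewrite apE.
by rewrite /pairing linear0; symmetry; exact: (@zero_lfunE K U K^o z).
Qed.

(** Its range, for z in U, is the subspace of U x U attached to the point generated by [Q]; left
    multiplication of [Q] by a unit only reparametrizes it. *)
Definition row_ap Q z : U * U := (ap (Q 0 0) z, ap (Q 0 1) z).

Lemma rap_rw a b z : row_ap (rw a b) z = (ap a z, ap b z).
Proof. by rewrite /row_ap !mxE. Qed.
Lemma rap_scale a Q z : row_ap (a *: Q) z = row_ap Q (ap a z).
Proof. by rewrite /row_ap !mxE !apE. Qed.
Lemma rap_mul P Q z w M : row_ap P z = row_ap Q w ->
  row_ap (P *m M) z = row_ap (Q *m M) w.
Proof. by rewrite /row_ap => -[e1 e2]; rewrite !mxE !sum2 !apE e1 e2. Qed.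
Lemma rap_inj P z : unimodular P -> row_ap P z = (0, 0) -> z = 0.
Proof.
move=> [n Pn] [e1 e2]; have := congr1 (fun M : 'M_1 => ap (M 0 0) z) Pn.
by rewrite !mxE sum2 !apE e1 e2 !apE addr0 /= => <-.
Qed.

Lemma distant_meet p q P Q z w : unimodular P -> unimodular Q ->
    val p = cyclic_submod P -> val q = cyclic_submod Q ->
  distant p q -> row_ap P z = row_ap Q w -> z = 0 /\ w = 0.
Proof.
move=> uP uQ pP qQ [M MG [pM qM]] e; have [N MN] := MG.
have [c cu cE] := cyclic_eq_unit uP (unimodular_row 0 MG) (etrans (esym pP) pM).
have [d du dE] := cyclic_eq_unit uQ (unimodular_row 1 MG) (etrans (esym qQ) qM).
move: e; rewrite cE dE !rap_scale => /(rap_mul N).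
rewrite (row_invertible MN) (row1_invertible MN) !rap_rw !apE => -[cz dw].
by split; [exact: unit_inj cu cz | exact: unit_inj du (esym dw)].
Qed.

(** Finite dimension enters here: by [inj_unit] a non-unit has a kernel vector, which becomes a
    common vector of the two subspaces. *)
Lemma nondistant_meet p q P Q : unimodular P -> unimodular Q ->
    val p = cyclic_submod P -> val q = cyclic_submod Q ->
  ~ distant p q -> exists z w, w <> 0 /\ row_ap P z = row_ap Q w.
Proof.
move=> uP uQ pP qQ; have [M [N [MN pM]]] := point_frame p.
have MG : GL2 (endo U) M by exists N.
have [c cE] := cyclic_mem (etrans (esym pM) pP).
rewrite (distant_frame MN pM uQ qQ) => nu.
have [w [w0 fw]] : exists w, w <> 0 /\ ap ((Q *m N) 0 1) w = 0.
  apply: contrapT => h; apply: nu; apply: (inj_unit fieldK) => w fw.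
  by apply: contrapT => w0; apply: h; exists w.
exists (ap c (ap ((Q *m N) 0 0) w)), w; split=> //.
rewrite -rap_scale -cE.
have : row_ap (Q *m N) w = row_ap (row 0 M *m N) (ap ((Q *m N) 0 0) w).
  by rewrite (row_invertible MN) rap_rw !apE /row_ap fw.
by move=> /(rap_mul M); rewrite -!mulmxA (proj2 MN) !mulmx1.
Qed.

(** Both subspaces are lines of U x U, so one common nonzero vector makes them equal; [tens r a] is
    the unit relating the generators. *)
Lemma cyclic_eq_dim1 P Q z w : dim U = 1%N -> unimodular P -> unimodular Q ->
  w <> 0 -> row_ap P z = row_ap Q w -> cyclic_submod P = cyclic_submod Q.
Proof.
move=> dimU uP uQ w0 e.
have sub A B (a b : U) : unimodular B -> b <> 0 -> row_ap A a = row_ap B b ->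
  exists2 c, unit_elt c & B = c *: A.
  move=> uB b0 eab; have [r rb] := exists_form fieldK b0.
  have a0 : a <> 0.
    by move=> a0; apply: b0; apply: (rap_inj uB); rewrite -eab a0 /row_ap !apE.
  have [l lE] := dim1_scale fieldK b dimU a0.
  exists (tens r a).
    apply: (inj_unit fieldK) => t; rewrite tensE.
    have [k ->] := dim1_scale fieldK t dimU b0.
    rewrite pairingZl rb mulr1 => ka.
    case: (EM (k = 0)) => [->|k0]; first by rewrite scale0r.
    by case: a0; rewrite -[a]scale1r -(fmulVr fieldK k0) -scalerA ka scaler0.
  have main i t : ap (B 0 i) t = ap (tens r a * A 0 i) t.
    have [k ->] := dim1_scale fieldK t dimU b0.
    rewrite !apE tensE rb scale1r.
    by case: eab => e1 e2; case: (ord2P i) => ->; rewrite ?e1 ?e2.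
  by apply/rowP => i; rewrite mxE; apply: endo_ext => t; exact: main.
by have [c cu ->] := sub _ _ _ _ uQ w0 e; rewrite cyclic_unit.
Qed.

Lemma dim1_distant p q : dim U = 1%N -> p <> q -> distant p q.
Proof.
move=> dimU pq; apply: contrapT => nd.
have [M [N [MN pM]]] := point_frame p;
  have [M' [N' [MN' qM']]] := point_frame q.
have uM : unimodular (row 0 M) by apply: unimodular_row; exists N.
have uM' : unimodular (row 0 M') by apply: unimodular_row; exists N'.
have [z [w [w0 e]]] := nondistant_meet uM uM' pM qM' nd.
by apply: pq; apply: val_inj; rewrite pM qM';
  exact: cyclic_eq_dim1 dimU uM uM' w0 e.
Qed.

Section Adjacency.
Hypothesis dimU : (1 < dim U)%N.
Let T := endo_tensor fieldK dimU.
Let CT := endo_cotensor fieldK dimU.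

(* The third point R(e + (1-f)x, 1-f) lies in the pencil of R(x,1) and R(x+e,1);
   for x = 0 it is the point at infinity of that pencil. *)
Lemma tens_adj x r u : r <> 0 -> u <> 0 -> adjacent (pt x) (pt (x + tens r u)).
Proof.
move=> r0 u0; have [u0' /= ru0] := sep1 fieldK T r0.
have [r' r'u] := exists_form fieldK u0.
(* [e] and [e'] are partial inverses: e e' = f and e' e = f' are idempotents. These relations make
   the matrices in [MN] mutually inverse. *)
pose e := tens r u; pose f := tens r u0'; pose e' := tens r' u0';
  pose f' := tens r' u.
have ee' : e * e' = f by rewrite tens_mul r'u scale1r.
have e'e : e' * e = f' by rewrite tens_mul ru0 scale1r.
have fe : f * e = e by rewrite tens_mul ru0 scale1r.
have ff : f * f = f by rewrite tens_mul ru0 scale1r.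
have f'f' : f' * f' = f' by rewrite tens_mul r'u scale1r.
have ef' : e * f' = e by rewrite tens_mul r'u scale1r.
have e'f : e' * f = e' by rewrite tens_mul ru0 scale1r.
have f'e' : f' * e' = e' by rewrite tens_mul r'u scale1r.
have MN : inverse_mx (mx2 e (1 - f) (1 - f') e') (mx2 e' (1 - f') (1 - f) e).
  split; rewrite mul_mx2 mx2_1 !(mulrBl, mulrBr, mul1r, mulr1, ee', e'e, fe,
    ff, f'f', ef', e'f, f'e').
    by rewrite !subrr !subr0 !addr0 [f + _]addrC !subrK.
  by rewrite !subrr !subr0 !addr0 [f' + _]addrC !subrK.
have en : e <> 0 by move/tens_eq0 => [].
have TN : inverse_mx (mx2 1 0 x 1) (mx2 1 0 (- x) 1).
  by split; rewrite mul_mx2 mx2_1 !(mul0r, mulr0, mul1r, mulr1, addr0,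
    add0r) ?subrr ?addNr.
have MTN := inverse_mxM MN TN.
have [c cE] := point_exists MTN.
move: cE; rewrite row_mul row0_mx2 mul_rw !mulr1 mulr0 add0r => cE.
have uc : unimodular (rw (e + (1 - f) * x) (1 - f)).
  have := unimodular_row 0 (ex_intro _ _ MTN).
  by rewrite row_mul row0_mx2 mul_rw !mulr1 mulr0 add0r.
split.
  by move/pt_inj/eqP; rewrite -[X in X == _]addr0 => /eqP/addrI/esym.
exists c; split.
- move=> /(congr1 val); rewrite cE ptE => /cyclic_mem[k].
  rewrite scale_rw mulr1 => /rw_inj[e1 e2]; apply: en.
  by move: e1; rewrite -e2 => /eqP; rewrite -subr_eq0 addrK => /eqP.
- move=> /(congr1 val); rewrite cE ptE => /cyclic_mem[k].
  rewrite scale_rw mulr1 => /rw_inj[e1 e2]; apply: en.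
  move: e1; rewrite -e2 mulrDr addrC => /addrI.
  by rewrite -/e mulrBl fe mul1r subrr.
move=> s sc; apply: contrapT => nd.
have [M [N [sMN sM]]] := point_frame s.
have uM : unimodular (row 0 M) by apply: unimodular_row; exists N.
have [z [w [w0]]] := nondistant_meet uM (unimodular_affine x) sM (ptE x) (fun h
  => nd (or_introl h)).
have [z' [w' [w'0]]] := nondistant_meet uM (unimodular_affine (x + tens r u))
  sM (ptE _) (fun h => nd (or_intror h)).
have cM t v : t <> 0 ->
  row_ap (row 0 M) v = row_ap (rw (e + (1 - f) * x) (1 - f)) t -> False.
  by move=> t0 h; have [_] := distant_meet uM uc sM cE sc h.
rewrite !rap_rw !apE => hw' hw.
(* The subspace of [c] consists of the vectors (k u + x v, v) with k in K and v in the kernel of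
   [r]. *)
have crap t : row_ap (rw (e + (1 - f) * x) (1 - f)) t =
    (pairing t r *: u + ap x (t - pairing t r *: u0'), t - pairing t r *: u0').
  by rewrite rap_rw !apE !tensE !apE.
have [rw0|rw0] := EM (pairing w r = 0).
  by apply: (cM w z w0); rewrite crap rw0 !scale0r add0r subr0.
have [rw'0|rw'0] := EM (pairing w' r = 0).
  by apply: (cM w' z' w'0);
    rewrite crap hw' !tensE rw'0 !scale0r add0r subr0 addr0.
(* Scaled to value 1 under [r], [w] and [w'] differ by some [d] in the kernel of [r]. The difference
   of the corresponding vectors of [s] is (u + x d, d), which belongs to [c]. *)
pose k := (pairing w r)^-1; pose k' := (pairing w' r)^-1.
pose d := k' *: w' - k *: w.
have pd : pairing d r = 0.
  by rewrite pairingDl -scaleNr !pairingZl mulNr !fmulVr // subrr.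
have pt1 : pairing (u0' + d) r = 1 by rewrite pairingDl pd addr0.
apply: (cM (u0' + d) (k' *: z' - k *: z)).
  by move=> h; move: pt1; rewrite h /pairing linear0 => /eqP;
    rewrite eq_sym oner_eq0.
rewrite crap pt1 !scale1r [u0' + d]addrC addrK /d.
rewrite /row_ap !apDr !apNr !apZ; move: hw hw';
  rewrite /row_ap => -[-> ->] [-> ->].
rewrite !tensE scalerDr scalerA fmulVr // scale1r; congr pair.
by rewrite addrAC addrC.
Qed.

Lemma rank1_of_kernel (r : dual U) x : r <> 0 ->
  (forall z, pairing z r = 0 -> ap x z = 0) -> exists u, x = tens r u.
Proof.
move=> r0 h; have [u0 /= ru0] := sep1 fieldK T r0.
exists (ap x u0); apply: endo_ext => z; rewrite tensE.
have : ap x (z - pairing z r *: u0) = 0.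
  by apply: h; rewrite pairingDl -scaleNr pairingZl ru0 mulr1 subrr.
by rewrite !apE => /eqP; rewrite subr_eq0 => /eqP.
Qed.

(* R(a,b) and R(a',b') are the two given points and R(1,0) is the third one.  If
   the second components of vectors of the two points were not all proportional,
   some R(t,1) would meet both points nontrivially;
     similarly for the kernels. *)
Lemma shared_hyperplane a b a' b' : unit_elt a -> b <> 0 -> b' <> 0 ->
    (forall t, unit_elt (a - b * t) \/ unit_elt (a' - b' * t)) ->
  exists2 r : dual U, r <> 0 & forall z, pairing z r = 0 ->
    exists w, ap a w = ap a' z /\ ap b w = ap b' z.
Proof.
move=> [ai [aai aia]] b0 b'0 H.
have nz x : x <> 0 -> exists v, ap x v <> 0.
  move=> x0; apply: contrapT => h; apply: x0; apply: endo_ext => z.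
  by rewrite [RHS]apE; apply: contrapT => hz; apply: h; exists z.
have clash u u' t : u <> 0 -> u' <> 0 -> ap t (ap b u) = ap a u ->
    ap t (ap b' u') = ap a' u' -> False.
  move=> u0 u'0 e e'; case: (H t) => h.
    by apply: u0; apply: (unit_inj h); rewrite !apE e subrr.
  by apply: u'0; apply: (unit_inj h); rewrite !apE e' subrr.
have bn x v : ap x v <> 0 -> v <> 0 by move=> xv v0; apply: xv; rewrite v0 apE.
have prop u u' : ap b u <> 0 -> ap b' u' <> 0 ->
  exists k, ap b u = k *: ap b' u'.
  move=> bu bu'; apply: contrapT => h.
  have ind k : ap b u <> k *: ap b' u' by move=> e; apply: h; exists k.
  have ind' k : ap b' u' <> k *: ap b u := scale_notin fieldK bu' ind (k := k).
  have fieldKc : GRing.field_axiom K^c := fieldK.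
  have [r1 /= [r11 r12]] := sep2 fieldKc (S := CT) ind.
  have [r2 /= [r21 r22]] := sep2 fieldKc (S := CT) ind'.
  (* This map sends [ap b u] to [ap a u] and [ap b' u'] to [ap a' u']. *)
  apply: (clash u u' (tens r1 (ap a u) + tens r2 (ap a' u'))).
  - exact: (bn b).
  - exact: (bn b').
  - by rewrite apD !tensE r11 r22 scale1r scale0r addr0.
  - by rewrite apD !tensE r12 r21 scale1r scale0r add0r.
have [u1 bu1] := nz _ b'0; have [u2 bu2] := nz _ b0.
have [t tv] := exists_form fieldK bu1.
set v := ap b' u1 in bu1 tv.
have bE u : ap b u = pairing (ap b u) t *: v.
  have [->|bu] := EM (ap b u = 0); first by rewrite /pairing linear0 scale0r.
  by have [k ->] := prop u u1 bu bu1; rewrite -/v pairingZl tv mulr1.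
have b'E u : ap b' u = pairing (ap b' u) t *: v.
  have [->|bu] := EM (ap b' u = 0); first by rewrite /pairing linear0 scale0r.
  have [k e] := prop u2 u bu2 bu.
  have k0 : k <> 0 by move=> k0; apply: bu2; rewrite e k0 scale0r.
  have -> : ap b' u = (k^-1 * pairing (ap b u2) t) *: v.
    by rewrite -scalerA -bE e scalerA fmulVr // scale1r.
  by rewrite pairingZl tv mulr1.
exists (transpose b' t).
  move=> r'0; apply: b'0; apply: endo_ext => z.
  rewrite b'E transposeE r'0 apE.
  by rewrite [pairing _ _](@zero_lfunE K U K^o) scale0r.
move=> z zr'; exists (ap ai (ap a' z)).
have z1 w : ap a (ap ai w) = w by rewrite -apM aia ap1.
split=> //; rewrite b'E transposeE zr' scale0r.
rewrite bE; suff -> : pairing (ap b (ap ai (ap a' z))) t = 0 by rewrite scale0r.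
apply: contrapT => c0; set w := ap ai (ap a' z) in c0.
(* The scalar [m] is chosen to make [ap b u] equal to [v]. Adding a multiple of [z], which [b']
   kills, leaves [ap b' u'] equal to [v], so one map can clash with both points. *)
pose m := (1 - pairing (ap b (ap ai (ap a' u1))) t) * (pairing (ap b w) t)^-1.
pose u' := u1 + m *: z; pose u := ap ai (ap a' u').
have bu : ap b u = v.
  rewrite bE /u /u' !apDr !apZ pairingDl pairingZl -/w /m -mulrA fmulVr //
    mulr1.
  by rewrite addrC subrK scale1r.
have bu' : ap b' u' = v.
  by rewrite /u' apDr apZ [ap b' z]b'E transposeE zr' scale0r scaler0 addr0.
apply: (clash u u' (tens t (ap a u))).
- by apply: (bn b); rewrite bu.
- by apply: (bn b'); rewrite bu'.
- by rewrite bu tensE tv scale1r.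
- by rewrite bu' tensE tv scale1r /u z1.
Qed.

(** In coordinates where the third point is R(1,0), every R(t,1) is distant to it, hence to one of
    the given points: this is the hypothesis of [shared_hyperplane]. Back in the old coordinates,
    common vectors have equal second components, so [y - x] vanishes on a hyperplane. *)
Lemma adj_tens x y : adjacent (pt x) (pt y) -> exists r u, y - x = tens r u.
Proof.
move=> [_ [c [cx cy H]]]; have [M [N [MN cM]]] := point_frame c.
have uM : unimodular (row 0 M) by apply: unimodular_row; exists N.
pose P := rw x 1 *m N; pose Q := rw y 1 *m N.
have key t : unit_elt (P 0 0 - P 0 1 * t) \/ unit_elt (Q 0 0 - Q 0 1 * t).
  have MtN := inverse_mxM (shear_inverse t) MN.
  have [s sE] := point_exists MtN.
  have Np (p : proj_line (endo U)) V : unimodular V ->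
    val p = cyclic_submod V ->
      distant s p <-> unit_elt ((V *m N) 0 0 - (V *m N) 0 1 * t).
    move=> uV pV; rewrite (distant_frame MtN sE uV pV) mulmxA.
    by rewrite {1}[V *m N]rwE mul_rw [X in unit_elt X]mxE /= mulrN1 -unit_eltN
      opprD opprK.
  rewrite /P /Q -(Np _ _ (unimodular_affine x) (ptE x)).
  rewrite -(Np _ _ (unimodular_affine y) (ptE y)); apply: H.
  apply/(Np _ _ uM cM); rewrite (row_invertible MN) !mxE /= mul0r subr0.
  exact: unit_elt1.
have back V : unimodular V -> V = (V *m N) *m M.
  by rewrite -mulmxA (proj2 MN) mulmx1.
have b0 V (p : proj_line (endo U)) : unimodular V -> val p = cyclic_submod V ->
    c <> p -> (V *m N) 0 1 <> 0.
  move=> uV pV cp b0; apply: cp; apply: val_inj; rewrite pV cM.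
  have VE : V = (V *m N) 0 0 *: row 0 M.
    rewrite {1}(back V uV) {1}[V *m N]rwE b0 -[_ *: _]mulmx1 -(proj2 MN) mulmxA.
    by rewrite -scalemxAl (row_invertible MN) scale_rw mulr1 mulr0.
  rewrite VE cyclic_unit //; apply: (inj_unit fieldK) => z az.
  by apply: (rap_inj uV); rewrite VE rap_scale az /row_ap !apE.
have Pb0 := b0 _ _ (unimodular_affine x) (ptE x) cx.
have Qb0 := b0 _ _ (unimodular_affine y) (ptE y) cy.
have concl (x1 y1 : endo U) : (exists2 r : dual U, r <> 0 & forall z,
  pairing z r = 0 ->
    exists w, row_ap (rw x1 1 *m N) w = row_ap (rw y1 1 *m N) z) ->
    exists r u, y1 - x1 = tens r u.
  move=> [r r0 h]; exists r; apply: rank1_of_kernel => // z /h[w /(rap_mul M)].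
  rewrite -!back; try exact: unimodular_affine.
  by rewrite !rap_rw !ap1 apD apN => -[+ wz]; rewrite wz => ->; rewrite subrr.
have [ua|ua] : unit_elt (P 0 0) \/ unit_elt (Q 0 0).
  by have := key 0; rewrite !mulr0 !subr0.
  apply: concl; have [r r0 h] := shared_hyperplane ua Pb0 Qb0 key.
  exists r => // z /h[w [h1 h2]]; exists w.
  by rewrite /row_ap -/P -/Q h1 h2.
have [|r [u e]] := concl y x; last first.
  exists (- r), u; rewrite -opprB e; apply: endo_ext => z.
  rewrite apN !tensE; have -> : pairing z (- r) = - pairing z r.
    exact: (@opp_lfunE K U K^o).
  by rewrite scaleNr.
have key' t : unit_elt (Q 0 0 - Q 0 1 * t) \/ unit_elt (P 0 0 - P 0 1 * t).
  by case: (key t); [right|left].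
have [r r0 h] := shared_hyperplane ua Qb0 Pb0 key'.
exists r => // z /h[w [h1 h2]]; exists w.
by rewrite /row_ap -/P -/Q h1 h2.
Qed.

Lemma rk1_adj x y : rk1 T (y - x) <-> x = y \/ adjacent (pt x) (pt y).
Proof.
split=> [[r [u /= e]]|[->|/adj_tens //]].
  have [r0|r0] := EM (tens r u = 0).
    by left; move/eqP: e; rewrite r0 subr_eq0 => /eqP.
  right; rewrite -[y](subrK x) e addrC; apply: tens_adj.
    by move=> h; apply: r0; rewrite h; exact: (tn0l T).
  by move=> h; apply: r0; rewrite h; exact: (tn0r T).
by rewrite subrr; exists 0, 0; rewrite tn0l.
Qed.

Lemma corank1_adj x y : rk1 CT (y - x) <-> x = y \/ adjacent (pt x) (pt y).
Proof.
rewrite -rk1_adj; split=> -[r [u e]]; by exists u, r.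
Qed.

(** A form [s] with value 1 on [w - v] can be scaled to value 1 at [v], or, if it vanishes at [v],
    added to a form with value 1 there; either result is 1 at [v] but not at [w]. *)
Lemma vec_eq (v w : U) :
  (forall r, pairing v r = 1 <-> pairing w r = 1) -> v = w.
Proof.
move=> h; have [v0|v0] := EM (v = 0).
  rewrite v0; symmetry; apply: contrapT => /(exists_form fieldK)[r].
  by move/h; rewrite v0 /pairing linear0 => /eqP; rewrite eq_sym oner_eq0.
have hd r : pairing v r = 1 -> pairing (w - v) r = 0.
  move=> vr; rewrite -scaleN1r pairingDl pairingZl vr ((h r).1 vr).
  by rewrite mulN1r subrr.
apply/eqP; rewrite eq_sym -subr_eq0; apply/eqP; apply: contrapT.
move=> /(exists_form fieldK)[s ds]; have [r vr] := exists_form fieldK v0.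
have [vs|vs] := EM (pairing v s = 0).
  have := hd (r + s); rewrite !dual_addE vr vs addr0 ds (hd _ vr) add0r.
  by move=> /(_ erefl)/eqP; rewrite oner_eq0.
have := hd (((pairing v s)^-1 : K^c) *: s); rewrite !pairing_scale ds mul1r.
by rewrite fmulrV // => /(_ erefl); exact: finv_neq0.
Qed.

(** By [stable_range] some R(x0,1) is distant to both points. They can then be written R(1 + b x0,
    b) and R(1 + b' x0, b'), and distance to R(x0 + y,1) says that 1 - b y, resp. 1 - b' y, is a
    unit; tensors y determine b by [unit_tens]. *)
Lemma point_eq p q : (forall x, distant (pt x) p <-> distant (pt x) q) -> p = q.
Proof.
move=> pq; have [M [N [MN pM]]] := point_frame p.
have [M' [N' [MN' qM]]] := point_frame q.
have uM : unimodular (row 0 M) by apply: unimodular_row; exists N.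
have uM' : unimodular (row 0 M') by apply: unimodular_row; exists N'.
set P := row 0 M in uM pM; set Q := row 0 M' in uM' qM.
have H x : unit_elt (P 0 0 - P 0 1 * x) <-> unit_elt (Q 0 0 - Q 0 1 * x).
  by rewrite -(pt_distant x uM pM) -(pt_distant x uM' qM).
have [|x0 ux0] := stable_range fieldK (a := P 0 0) (b := P 0 1).
  by move=> z h1 h2; apply: (rap_inj uM); rewrite /row_ap h1 h2.
have ux0' := (H x0).1 ux0.
have [l [l1 l2]] := ux0; have [l' [l1' l2']] := ux0'.
pose b := l * P 0 1; pose b' := l' * Q 0 1.
have PE : cyclic_submod P = cyclic_submod (rw (1 + b * x0) b).
  rewrite -(cyclic_unit P (c := l)); last by exists (P 0 0 - P 0 1 * x0).
  rewrite [P in _ *: P]rwE scale_rw; congr (cyclic_submod (rw _ _)).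
  by rewrite -l2 /b -mulrA -mulrDr subrK.
have QE : cyclic_submod Q = cyclic_submod (rw (1 + b' * x0) b').
  rewrite -(cyclic_unit Q (c := l')); last by exists (Q 0 0 - Q 0 1 * x0).
  rewrite [Q in _ *: Q]rwE scale_rw; congr (cyclic_submod (rw _ _)).
  by rewrite -l2' /b' -mulrA -mulrDr subrK.
apply: val_inj; rewrite pM qM PE QE.
suff -> : b = b' by [].
have ul : unit_elt l by exists (P 0 0 - P 0 1 * x0).
have ul' : unit_elt l' by exists (Q 0 0 - Q 0 1 * x0).
have H2 y : unit_elt (1 - b * y) <-> unit_elt (1 - b' * y).
  have e1 : l * (P 0 0 - P 0 1 * (x0 + y)) = 1 - b * y.
    by rewrite [P 0 1 * _]mulrDr opprD addrA mulrDr l2 mulrN /b mulrA.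
  have e2 : l' * (Q 0 0 - Q 0 1 * (x0 + y)) = 1 - b' * y.
    by rewrite [Q 0 1 * _]mulrDr opprD addrA mulrDr l2' mulrN /b' mulrA.
  have ulx (c x : endo U) : unit_elt c -> unit_elt (c * x) <-> unit_elt x.
    move=> uc; split=> h; last exact: unit_eltM.
    have [d [cd dc]] := uc; rewrite -[x]mul1r -dc -mulrA.
    by apply: unit_eltM => //; exists c.
  by rewrite -e1 -e2 ulx // ulx.
have H3 u r : pairing (ap b u) r = 1 <-> pairing (ap b' u) r = 1.
  have key c : unit_elt (1 - c * tens r u) <-> pairing (ap c u) r <> 1.
    by rewrite tens_mull unit_tens transposeE.
  have := H2 (tens r u); rewrite !key => h.
  by split=> e; apply: contrapT => ne; [apply: (h.2 ne)|apply: (h.1 ne)].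
by apply: endo_ext => u; apply: vec_eq => r; exact: H3.
Qed.

End Adjacency.
End EndoLine.

(** * Semilinear representation of isomorphisms and anti-isomorphisms *)

Lemma rmorphism_of (R S : pzRingType) (f : R -> S) :
    (forall x y, f (x + y) = f x + f y) -> f 1 = 1 ->
    (forall x y, f (x * y) = f x * f y) ->
  exists g : {rmorphism R -> S}, forall x, g x = f x.
Proof.
move=> fD f1 fM.
have f0 : f 0 = 0 by have := fD 0 0; rewrite addr0 -{1}[f 0]addr0 => /addrI.
have fB : GRing.zmod_morphism f.
  by move=> x y; apply/eqP; rewrite eq_sym subr_eq -fD subrK.
have fm : GRing.monoid_morphism f by split.
pose g : {rmorphism R -> S} := HB.pack f (GRing.isZmodMorphism.Build R S f fB)
  (GRing.isMonoidMorphism.Build R S f fm).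
by exists g.
Qed.

Section SemilinearRepresentation.
Variables (F K' : unitRingType) (fieldF : GRing.field_axiom F).
Variables (fieldK' : GRing.field_axiom K').
Variables (M : lmodType F) (S : pzRingType) (U' : vectType K').
Variables (act : M -> S -> M) (t : M -> S).
Hypothesis actZ : forall k u x, act (k *: u) x = k *: act u x.
Hypothesis act_trans : forall u v, u <> 0 -> exists x, act u x = v.
Hypothesis act_sep : forall u v, (forall k, v <> k *: u) ->
  exists x, act u x = 0 /\ act v x <> 0.
Hypothesis tD : forall u v, t (u + v) = t u + t v.
Hypothesis t_act : forall u x, t u * x = t (act u x).
Hypothesis t_neq0 : exists u, t u <> 0.

Lemma endo_trans (u v : U') : u <> 0 -> exists y, ap y u = v.
Proof.
move=> /(exists_form fieldK')[r ru]; exists (tens r v).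
by rewrite tensE ru scale1r.
Qed.

Lemma endo_sep (u v : U') : (forall k, v <> k *: u) ->
  exists y, ap y u = 0 /\ ap y v <> 0.
Proof.
move=> vu; have [->|/(exists_form fieldK')[r ru]] := EM (u = 0).
  by exists 1; rewrite !ap1; split=> // v0; apply: (vu 0); rewrite scale0r.
exists (1 - tens r u); rewrite !apE !tensE ru scale1r subrr; split=> //.
by move=> /eqP; rewrite subr_eq0 => /eqP; exact: vu.
Qed.

Lemma scaleIv (v : U') k l : v <> 0 -> k *: v = l *: v -> k = l.
Proof.
move=> v0 /eqP; rewrite -subr_eq0 -scalerBl => /eqP kl.
apply: contrapT => h; apply: v0.
have kl0 : k - l <> 0 by move/eqP; rewrite subr_eq0 => /eqP.
by rewrite (scale_cancel fieldK' kl0 kl) scaler0.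
Qed.

(** By [t_act] the image of [t] is a right ideal; in the uses below it consists of the tensors with
    a fixed form or a fixed vector. Evaluating [alpha (t u)] at a suitable [w] gives a map [h]
    intertwining [act] with the action through [alpha]; transitivity and separation make it
    bijective and semilinear. *)
Theorem semilinear_representation (alpha : {rmorphism S -> endo U'}) :
    bijective alpha ->
  exists (sigma : {rmorphism F -> K'}) (h : {linear M -> U' | sigma \; *:%R})
    (hV : U' -> M),
    [/\ bijective sigma, cancel h hV, cancel hV h &
      forall x v, ap (alpha x) v = h (act (hV v) x)].
Proof.
move=> [beta alphaK betaK]; have [u0 tu0] := t_neq0.
have [w hw] : exists w, ap (alpha (t u0)) w <> 0.
  apply: contrapT => hn; apply: tu0; rewrite -(alphaK (t u0)) -(alphaK 0).
  congr beta; apply: endo_ext => w; rewrite raddf0 ap0.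
  by apply: contrapT => h; apply: hn; exists w.
pose h u := ap (alpha (t u)) w.
have hact u x : h (act u x) = ap (alpha x) (h u).
  by rewrite /h -t_act rmorphM apM.
have hD u v : h (u + v) = h u + h v by rewrite /h tD rmorphD apD.
have h0 : h 0 = 0 by have := hD 0 0; rewrite addr0 -{1}[h 0]addr0 => /addrI.
have hB u v : h (u - v) = h u - h v.
  by apply/eqP; rewrite eq_sym subr_eq -hD subrK.
have hn0 u : u <> 0 -> h u <> 0.
  by move=> un hu; have [x ux] := act_trans u0 un; apply: hw;
     rewrite -/(h u0) -ux hact hu ap0r.
have hinj u v : h u = h v -> u = v.
  move=> e; apply/eqP; rewrite -subr_eq0; apply/eqP; apply: contrapT => /hn0.
  by rewrite hB e subrr.
have u0n : u0 <> 0 by move=> u00; apply: hw; rewrite -/(h u0) u00.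
have hsurj v : exists u, h u = v.
  have [y yv] := endo_trans v hw; exists (act u0 (beta y)).
  by rewrite hact betaK.
have [hV hVK] := choice hsurj.
have hK u : hV (h u) = u by apply: hinj; rewrite hVK.
(* Otherwise some [y] kills [h u0] but not [h (k *: u0)]; pulled back through [alpha] it kills [u0],
   hence also [k *: u0]. *)
have /choice[s sP] k : exists l, h (k *: u0) = l *: h u0.
  apply: contrapT => hn; have [|y [y0 yk]] := @endo_sep (h u0) (h (k *: u0)).
    by move=> l e; apply: hn; exists l.
  apply: yk; rewrite -(betaK y) -hact actZ.
  have -> : act u0 (beta y) = 0 by apply: hinj; rewrite hact betaK y0 h0.
  by rewrite scaler0 h0.
have hZ k u : h (k *: u) = s k *: h u.
  have [x <-] := act_trans u u0n.
  by rewrite -actZ !hact sP apZ.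
have sinj0 k l : k *: h u0 = l *: h u0 -> k = l by exact: scaleIv.
have sD k l : s (k + l) = s k + s l.
  by apply: sinj0; rewrite scalerDl -!hZ scalerDl hD.
have s1 : s 1 = 1 by apply: sinj0; rewrite -hZ !scale1r.
have sM k l : s (k * l) = s k * s l.
  by apply: sinj0; rewrite -scalerA -!hZ scalerA.
have [sigma sigmaE] := rmorphism_of sD s1 sM.
have hlin : linear_for (sigma \; *:%R) h.
  by move=> k u v; rewrite hD hZ /= sigmaE.
pose hl : {linear M -> U' | sigma \; *:%R} := HB.pack h
  (GRing.isLinear.Build F M U' (sigma \; *:%R) h hlin).
exists sigma, hl, hV; split=> //; last by move=> x v; rewrite /= hact hVK.
have sinj : injective s.
  move=> k l kl; apply/eqP; rewrite -subr_eq0; apply/eqP;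
    apply: contrapT => kl0.
  have kl1 : (k - l) *: u0 = 0.
    by apply: hinj; rewrite scalerBl hB !hZ kl subrr h0.
  by apply: u0n; rewrite (scale_cancel fieldF kl0 kl1) scaler0.
(* Conversely, a preimage of [k' *: h u0] off the line of [u0] would be separated from [u0] by some
   [x], whereas [alpha x] kills [h u0] and its multiples. *)
have /choice[s' s'P] k' : exists k, s k = k'.
  have [v hv] := hsurj (k' *: h u0).
  have [[k vk]|hn] := EM (exists k, v = k *: u0).
    by exists k; apply: sinj0; rewrite -hv vk hZ.
  have [|x [x0 xv]] := @act_sep u0 v; first by move=> k e; apply: hn; exists k.
  by case: (hn0 _ xv); rewrite hact hv apZ -hact x0 h0 scaler0.
exists s' => k; rewrite ?sigmaE ?s'P //.
by apply: sinj; rewrite s'P.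
Qed.
End SemilinearRepresentation.

Section Representations.
Variables (K K' : unitRingType).
Variables (fieldK : GRing.field_axiom K) (fieldK' : GRing.field_axiom K').
Variables (U : vectType K) (U' : vectType K').
Hypothesis dimU : (1 < dim U)%N.

Lemma iso_representation (alpha : {rmorphism endo U -> endo U'}) :
    bijective alpha ->
  exists (sigma : {rmorphism K -> K'}) (h : {linear U -> U' | sigma \; *:%R})
    (hV : U' -> U),
    [/\ bijective sigma, cancel h hV, cancel hV h &
      forall x v, ap (alpha x) v = h (ap x (hV v))].
Proof.
have [r0 r0n] := exists_neq0_dual (endo_tensor fieldK dimU).
have [u0 u0n] := exists_neq0 (endo_tensor fieldK dimU).
apply: (@semilinear_representation _ _ fieldK fieldK' U (endo U) U'
  (fun u x => ap x u) (tens r0)).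
- by move=> k u x; exact: apZ.
- by move=> u v; exact: endo_trans.
- by move=> u v; exact: endo_sep.
- exact: (tnDr (endo_tensor fieldK dimU)).
- by move=> u x; exact: mul_tens.
- by exists u0 => /(tens_eq0 fieldK)[].
Qed.

Lemma anti_representation (alpha : {rmorphism (endo U)^c -> endo U'}) :
    bijective alpha ->
  exists (sigma : {rmorphism K^c -> K'})
    (h : {linear dual U -> U' | sigma \; *:%R}) (hV : U' -> dual U),
    [/\ bijective sigma, cancel h hV, cancel hV h &
      forall x v, ap (alpha x) v = h (transpose (x : endo U) (hV v))].
Proof.
have [r0 r0n] := exists_neq0_dual (endo_tensor fieldK dimU).
have [u0 u0n] := exists_neq0 (endo_tensor fieldK dimU).
have fieldKc : GRing.field_axiom K^c := fieldK.
apply: (@semilinear_representation K^c _ fieldKc fieldK' (dual U) (endo U)^c U'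
  (fun r x => transpose (x : endo U) r) (fun r => tens r u0)).
- move=> k r x; apply: dual_eq => u.
  by rewrite -transposeE !pairing_scale -transposeE.
- move=> r s /(sep1 fieldK (endo_tensor fieldK dimU))[u /= ru];
  exists (tens s u).
  apply: dual_eq => z; rewrite -transposeE [X in pairing X _]tensE pairingZl.
  by rewrite ru mulr1.
- move=> r s sr; have [r00|/(sep1 fieldK (endo_tensor fieldK dimU))[u /= ru]]
  := EM (r = 0).
    exists 1; split; first by apply: dual_eq => z;
      rewrite -transposeE [X in pairing X _]ap1 r00.
    move=> h; apply: (sr 0); rewrite scale0r -h; apply: dual_eq => z.
    by rewrite -transposeE [X in _ = pairing X _]ap1.
  have tz q z : pairing z (transpose (1 - tens r u) q) = pairing z q - pairing
    z r * pairing u q.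
    rewrite -transposeE [X in pairing X _]apD ap1 apN tensE -scaleNr pairingDl
      pairingZl.
    by rewrite mulNr.
  exists (1 - tens r u : endo U); split.
    apply: dual_eq => z; rewrite tz ru mulr1 subrr.
    by symmetry; exact: (@zero_lfunE K U K^o z).
  move=> h; apply: (sr (pairing u s)); apply: dual_eq => z.
  have := tz s z; rewrite h pairing_scale.
  rewrite [pairing z 0](@zero_lfunE K U K^o z) => /esym/eqP.
  by rewrite subr_eq0 => /eqP.
- by move=> r s; exact: (tnDl (endo_tensor fieldK dimU)).
- by move=> r x; exact: (tens_mull r u0 (x : endo U)).
- by exists r0 => /(tens_eq0 fieldK)[].
Qed.
End Representations.

(** * Normalized distance isomorphisms *)

Section Main.
Variables (K K' : unitRingType).
Variables (fieldK : GRing.field_axiom K) (fieldK' : GRing.field_axiom K').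
Variables (U : vectType K) (U' : vectType K').

(** In dimension 1 distinct points are distant, while in larger dimension R(0,1) and R(tens r u,1)
    are distinct but not distant, since a single tensor kills a nonzero vector. *)
Lemma dim1_dist_isomorphism (phi : proj_line (endo U) -> proj_line (endo U')) :
  dist_isomorphism phi -> dim U = 1%N -> ~ (1 < dim U')%N.
Proof.
move=> [[psi phiK psiK] phiD] dimU dimU'.
have [u u0] := exists_neq0 (endo_tensor fieldK' dimU').
have [v vu] := exists_indep fieldK' (endo_tensor fieldK' dimU') u0.
have [r ru] := exists_form fieldK' u0.
have ne : psi (pt 0) <> psi (pt (tens r u)).
  move=> /(can_inj psiK)/pt_inj h; apply: u0.
  by rewrite -[u]scale1r -ru -tensE -h ap0.
have := dim1_distant fieldK dimU ne.
rewrite phiD !psiK pt_pt_distant subr0 => h.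
have := unit_inj h (z := v - pairing v r *: u).
rewrite !apE !tensE ru scale1r subrr => /(_ erefl)/eqP.
by rewrite subr_eq0 => /eqP; exact: vu.
Qed.

Section DimGe2.
Hypotheses (dimU : (1 < dim U)%N) (dimU' : (1 < dim U')%N).
Let T := endo_tensor fieldK dimU.
Let T' := endo_tensor fieldK' dimU'.
Let CT' := endo_cotensor fieldK' dimU'.

Variable phi : proj_line (endo U) -> proj_line (endo U').
Hypotheses (phiI : dist_isomorphism phi) (phi_inf : phi (pt_inf _) = pt_inf _).
Hypotheses (phi0 : phi (pt 0) = pt 0) (phi1 : phi (pt 1) = pt 1).

Lemma endo_ext_tensor (A B : endo U -> endo U') : A 0 = B 0 ->
    (forall x y, A (x + y) = A x + A y) ->
      (forall x y, B (x + y) = B x + B y) ->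
    (forall r u, A (tens r u) = B (tens r u)) -> forall x, A x = B x.
Proof.
move=> AB0 AD BD AB; apply: endo_ind => // a r u IH.
by rewrite AD BD IH AB.
Qed.

Lemma normalized_isomorphism :
  (exists2 alpha : {rmorphism endo U -> endo U'},
     bijective alpha & phi = hom_tilde alpha) \/
  (exists2 alpha : {rmorphism (endo U)^c -> endo U'},
     bijective alpha & phi = anti_tilde alpha).
Proof.
have [f [fE fbij f0 f1 fU]] := affine_part phiI phi_inf phi0 phi1.
have finj := bij_inj fbij.
have fadj x y : adjacent (pt x) (pt y) <-> adjacent (pt (f x)) (pt (f y)).
  by rewrite -!fE; exact: dist_isomorphism_adj.
have fxy x y : x = y <-> f x = f y by split=> [->|/finj].
have iso1 : rk1_iso T T' f.
  by split=> // x y; rewrite !rk1_adj -fadj -fxy.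
(* The same [f] seen as a map into the structure where forms and vectors are exchanged; the rank-one
   relation does not change. *)
have iso2 : rk1_iso T CT' f.
  by split=> // x y; rewrite rk1_adj corank1_adj -fadj -fxy.
have pr1 r u s v : f (tens r u) = tens s v ->
  pairing u r = 1 <-> pairing v s = 1.
  move=> e; have h : pairing u r <> 1 <-> pairing v s <> 1.
    by rewrite -(unit_tens fieldK) -(unit_tens fieldK') fU f1 e.
  by split=> e'; apply: contrapT => ne; [apply: (h.2 ne)|apply: (h.1 ne)].
have extend (psi : proj_line (endo U) -> proj_line (endo U')) :
    (forall p q, distant p q <-> distant (psi p) (psi q)) ->
    (forall x, psi (pt x) = pt (f x)) -> phi = psi.
  move=> psiD psiE; apply/funext => p; apply: (point_eq fieldK') => y.
  have [g _ gK] := fbij; rewrite -(gK y) -[X in _ <-> distant X _]psiE -psiD.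
  by rewrite -fE; case: phiI => _ <-.
have [[L J]|[LJ JL]] := rk1_iso_type fieldK fieldK' iso1.
  have LJf : LJ_iso T T' f by [].
  have fD := LJ_iso_additive fieldK fieldK' LJf.
  have [g [h [gh mul]]] := LJ_iso_mul fieldK fieldK' LJf pr1.
  have fM x y : f (x * y) = f x * f y.
    move: y; apply: endo_ext_tensor => [|y z|y z|s v];
      rewrite ?mulr0 ?f0 ?mulr0 ?fD ?mulrDr ?fD //.
    move: x; apply: endo_ext_tensor => [|y z|y z|r u];
      rewrite ?mul0r ?f0 ?mul0r ?fD ?mulrDl ?fD //.
    by rewrite tens_mul [LHS]mul (gh r u) (gh s v) /= tens_mul.
  have [alpha alphaE] := rmorphism_of fD f1 fM.
  have alphaf : (alpha : endo U -> endo U') = f by apply/funext.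
  left; exists alpha; first by rewrite alphaf.
  apply: extend; last by move=> x; rewrite hom_tilde_pt alphaE.
  by apply: hom_tilde_dist; rewrite alphaf.
(* [Jset T'] and [Lset CT'] describe the same sets, so an exchange of types for [T'] is a
   preservation of types for [CT']. *)
have LJf : LJ_iso T CT' f by [].
have fieldKc : GRing.field_axiom K'^c := fieldK'.
have fD := LJ_iso_additive fieldK fieldKc LJf.
have pr2 r u s v : f (tn T r u) = tn CT' s v -> pr T u r = 1 <-> pr CT' v s = 1.
  exact: pr1.
have [g [h [gh mul]]] := LJ_iso_mul fieldK fieldKc LJf pr2.
have fM x y : f (y * x) = f x * f y.
  move: y; apply: endo_ext_tensor => [|y z|y z|s v];
    rewrite ?mul0r ?f0 ?mulr0 ?fD ?mulrDr ?mulrDl ?fD //.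
  move: x; apply: endo_ext_tensor => [|y z|y z|r u];
    rewrite ?mulr0 ?f0 ?mul0r ?fD ?mulrDl ?mulrDr ?fD //.
  rewrite tens_mul [LHS]mul (gh r u) (gh s v) /= tens_mul.
  exact: (esym (tnZ CT' _ _ _)).
have [alpha alphaE] : exists g : {rmorphism (endo U)^c ->
  endo U'}, forall x, g x = f x.
  by apply: rmorphism_of => // x y; exact: fM.
have alphaf : (alpha : endo U -> endo U') = f by apply/funext.
right; exists alpha; first by rewrite alphaf.
apply: extend; last by move=> x; rewrite anti_tilde_pt alphaE.
by apply: anti_tilde_dist; rewrite alphaf.
Qed.
End DimGe2.
End Main.

Lemma distant_irrefl (K : unitRingType) (U : vectType K) (p : proj_line (endo
  U)) :
  (0 < dim U)%N -> ~ distant p p.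
Proof.
move=> dimU pp; have [M [N [MN pM]]] := point_frame p.
have uM : unimodular (row 0 M) by apply: unimodular_row; exists N.
have [] := distant_meet uM uM pM pM pp (erefl (row_ap (row 0 M) (cvec (Ordinal
  dimU)))).
by move/cvec_neq0.
Qed.

Theorem theorem5p4
    (K K' : unitRingType)
    (fieldK : GRing.field_axiom K) (fieldK' : GRing.field_axiom K')
    (U : vectType K) (U' : vectType K')
    (dimU_ge1 : (1 <= dim U)%N) (dimU'_ge1 : (1 <= dim U')%N)
    (phi : proj_line (endo U) -> proj_line (endo U'))
    (phi_bij : bijective phi) :
  (dist_isomorphism phi <->
     (dim U = 1%N /\ dim U' = 1%N)
     \/
     ((1 < dim U)%N /\
      exists gamma : GL2 (endo U'),
        (exists2 alpha : {rmorphism endo U -> endo U'},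
           bijective alpha & phi = projectivity gamma \o hom_tilde alpha)
        \/
        (exists2 alpha : {rmorphism (endo U)^c -> endo U'},
           bijective alpha & phi = projectivity gamma \o anti_tilde alpha)))
  /\
  ((1 < dim U)%N ->
   forall gamma : GL2 (endo U'),
     (forall alpha : {rmorphism endo U -> endo U'},
        bijective alpha -> phi = projectivity gamma \o hom_tilde alpha ->
        exists (sigma : {rmorphism K -> K'})
               (h : {linear U -> U' | sigma \; *:%R}) (hV : U' -> U),
          [/\ bijective sigma, cancel h hV, cancel hV h &
              forall x : endo U, alpha x =1 h \o x \o hV])
     /\
     (forall alpha : {rmorphism (endo U)^c -> endo U'},
        bijective alpha -> phi = projectivity gamma \o anti_tilde alpha ->
        exists (sigma : {rmorphism K^c -> K'})
               (h : {linear dual U -> U' | sigma \; *:%R}) (hV : U' -> dual U),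
          [/\ bijective sigma, cancel h hV, cancel hV h &
              forall x : endo U, alpha x =1 h \o transpose x \o hV])).
Proof.
split; last first.
  move=> dimU gamma; split=> alpha alpha_bij _.
    exact: (iso_representation fieldK fieldK' dimU alpha_bij).
  exact: (anti_representation fieldK fieldK' dimU alpha_bij).
split=> [phiI|[[dimU dimU']|[dimU [gamma alphaP]]]].
- have [dimU1|dimU1] := eqVneq (dim U) 1%N.
    left; split=> //; apply/eqP; rewrite eqn_leq dimU'_ge1 andbT leqNgt.
    by apply/negP; exact (dim1_dist_isomorphism fieldK fieldK' phiI dimU1).
  have dimU : (1 < dim U)%N by rewrite ltn_neqAle eq_sym dimU1.
  right; split=> //.
  have [psi phiK psiK] := phi_bij.
  have psiI := dist_isomorphism_inv phiK psiK phiI.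
  have dimU' : (1 < dim U')%N.
    rewrite ltn_neqAle dimU'_ge1 andbT; apply/negP => /eqP/esym dimU'1.
    exact (dim1_dist_isomorphism fieldK' fieldK psiI dimU'1 dimU).
  have [_ phiD] := phiI.
  (* The images of R(1,0), R(0,1) and R(1,1) are pairwise distant, so a projectivity [delta] returns
     them to the standard points; [gamma] will undo it. *)
  have [||| delta [dinf d0 d1]] := @normalize_triple _
      (phi (pt_inf _)) (phi (pt 0)) (phi (pt 1)).
  + by rewrite -phiD; exact: inf_pt_distant.
  + by rewrite -phiD; exact: inf_pt_distant.
  + by rewrite -phiD pt_pt_distant subr0; exact: unit_elt1.
  have [gamma dg] := GL2_inverse delta.
  have phiE : phi = projectivity gamma \o (projectivity delta \o phi).
    by apply/funext => p /=; rewrite (projectivityK dg).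
  exists gamma.
  have [[alpha ab ae]|[alpha ab ae]] := normalized_isomorphism fieldK fieldK'
    dimU dimU'
    (dist_isomorphism_comp phiI (projectivity_dist delta)) dinf d0 d1.
    by left; exists alpha => //; rewrite -ae.
  by right; exists alpha => //; rewrite -ae.
- split=> // p q.
  (* In dimension 1 being distant means being different, a relation that every bijection
     preserves. *)
  have distE (L : unitRingType) (V : vectType L) (fL : GRing.field_axiom L)
      (p1 q1 : proj_line (endo V)) : dim V = 1%N -> distant p1 q1 <-> p1 <> q1.
    move=> dimV; split; last exact: dim1_distant.
    by move=> pq e; move: pq; rewrite e; apply: distant_irrefl; rewrite dimV.
  rewrite !distE //; split=> pq e; apply: pq; last by rewrite e.
  exact: (bij_inj phi_bij e).
- split=> // p q; have [_ gD] := projectivity_dist gamma.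
  case: alphaP => [[alpha ab ->]|[alpha ab ->]] /=; rewrite -gD.
    exact: hom_tilde_dist.
  exact: anti_tilde_dist.
Qed.
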